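(* Let $d\ge 2$, $0<p<s<d$, $0<s<\bar s(d)$, and $M>0$. For each $Z>0$ let $\Omega_Z$ be a minimizer of $\mathbf{E}_Z$ among sets of measure $M$. Let $Z_n\to 0$ ($Z_n>0$) be a sequence along which $\Omega_n:=\Omega_{Z_n}$ satisfies one of the following two alternatives: (A) there is a set $E^0$ with $|E^0|=M$ and $\mathbf{E}_0(E^0)=e_0(M)$ such that $\chi_{\Omega_n}\to\chi_{E^0}$ in $L^1(\mathbb{R}^d)$ (in this case put $N=0$ and $m^0=M$); or (B) there are $N\in\mathbb{N}$ (with $N\ge1$); $\underline m=(m^0,\dots,m^N)$ with $m^i>0$ and $\sum_{i=0}^N m^i=M$; points $x_n^0,\dots,x_n^N\in\mathbb{R}^d$ with $x_n^0=0$, $|x_n^i|\to\infty$ for $i\neq0$ and $|x_n^i-x_n^j|\to\infty$ for $i\ne j$; and compact sets $E^0,\dots,E^N$ of finite perimeter with $|E^i|=m^i$, such that (a) $\partial^*\Omega_n$ is of class $C^{1,1/2}$, and for fixed $R>0$ such that all $E^i\subset B_R(0)$, $(\partial^*\Omega_n-x_n^i)\cap B_R(0)\to\partial^*E^i$ in $C^{1,\alpha}$ for all $\alpha\in(0,1/2)$; (b) $\big|\Omega_n\,\triangle\,[E^0\cup\bigcup_{i=1}^N(E^i+x_n^i)]\big|\to0$; (c) $e_0(m^i)=\mathbf{E}_0(E^i)$ for $i=0,\dots,N$; (d) $Z_n^{1/(s-p)}x_n^i\to y_i$ for $i=1,\dots,N$, where $(0,y_1,\dots,y_N)$ minimizes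 $\mathbf{F}_{N,\underline m}$ over $\Sigma_N$. Then the sets $E^0,\dots,E^N$ are all balls (up to null sets) with equal volume $m^i=M/(N+1)$, $i=0,1,\dots,N$.
   Context: For $Z\ge 0$ and a measurable set $\Omega\subset\mathbb{R}^d$ of finite Lebesgue measure, $$\mathbf{E}_Z(\Omega):=\operatorname{Per}(\Omega)+\int_\Omega\int_\Omega\frac{dx\,dy}{|x-y|^s}-Z\int_\Omega\frac{dx}{|x|^p},\qquad e_Z(m):=\inf\{\mathbf{E}_Z(\Omega):\ \Omega\subset\mathbb{R}^d,\ |\Omega|=m\},$$ where $\operatorname{Per}$ is the Caccioppoli perimeter ($+\infty$ for sets not of finite perimeter); $\mathbf{E}_0,e_0$ are the case $Z=0$. A minimizer of $\mathbf{E}_Z$ among sets of measure $M$ is a set $\Omega_Z$ with $|\Omega_Z|=M$, $\mathbf{E}_Z(\Omega_Z)=e_Z(M)$. Sets are understood up to null sets; $\partial^*$ is the reduced boundary; $\triangle$ is symmetric difference; $B_R(0)$ is the ball of radius $R$ centred at $0$. Convergence $(\partial^*\Omega_n-x_n^i)\cap B_R(0)\to\partial^*E^i$ in $C^{1,\alpha}$ means that for large $n$ the surface $(\partial^*\Omega_n-x_n^i)\cap B_R(0)$ is a normal graph $\{x+\psi_n(x)\nu_{E^i}(x):x\in\partial^*E^i\}$ with $\psi_n\to0$ in $C^{1,\alpha}$, $\nu_{E^i}$ the unit normal. $$\mathbf{F}_{N,\underline m}(y_0,\dots,y_N):=\sum_{\substack{i,j=0\\ i\ne j}}^N\frac{m^i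 m^j}{|y_i-y_j|^s}-\sum_{i=1}^N\frac{m^i}{|y_i|^p}$$ on $\Sigma_N:=\{(y_0,\dots,y_N)\in(\mathbb{R}^d)^{N+1}:\ y_0=0\}$, with value $+\infty$ if two points coincide. $\bar s(d)>0$ denotes the critical exponent of Bonacini and Cristoferi: a known result states that there is $\bar s(d)>0$ such that if $s\in(0,\bar s(d))$ then, for every $m>0$, any minimizer of $e_0(m)$ (when one exists) is a ball. *)

(* Defs.v *)
From HB Require Import structures.
From mathcomp Require Import all_boot all_order all_algebra.
From mathcomp Require Import all_classical all_reals all_analysis.

Set Implicit Arguments.
Unset Strict Implicit.
Unset Printing Implicit Defensive.

Import Order.TTheory GRing.Theory Num.Theory.
Import numFieldTopology.Exports numFieldNormedType.Exports.

Local Open Scope classical_set_scope.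
Local Open Scope ring_scope.

(* The sigma-algebra on R^n generated by the n coordinates, i.e. the Borel
   sets. Sets are only considered up to null sets, so Borel sets stand for all
   Lebesgue measurable ones. *)
Definition measure_rV_display : measure_display.
Proof. exact: default_measure_display. Qed.

Section measurable_rV.
Context {R : realType} (n : nat).

Let coor : 'I_n -> 'rV[R]_n -> R := fun i x => x ord0 i.

Let rV_set0 : g_sigma_preimage coor set0.
Proof. exact: sigma_algebra0. Qed.

Let rV_setC A : g_sigma_preimage coor A -> g_sigma_preimage coor (~` A).
Proof. exact: sigma_algebraC. Qed.

Let rV_bigcup (F : (set 'rV[R]_n)^nat) :
  (forall i, g_sigma_preimage coor (F i)) ->
  g_sigma_preimage coor (\bigcup_i (F i)).
Proof. exact: sigma_algebra_bigcup. Qed.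

HB.instance Definition _ := @isMeasurable.Build measure_rV_display
  'rV[R]_n (g_sigma_preimage coor) rV_set0 rV_setC rV_bigcup.

End measurable_rV.

Section lebesgue_rV.
Context {R : realType}.

Lemma measurable_coor n (i : 'I_n) :
  measurable_fun [set: 'rV[R]_n] (fun x : 'rV[R]_n => x ord0 i).
Proof.
move=> _ Y mY; rewrite setTI; apply: sub_sigma_algebra => /=.
rewrite -bigcup_seq/=; exists i => /=; first by rewrite mem_index_enum.
by exists Y => //; rewrite setTI.
Qed.

Lemma measurable_fun_coorP d (T : measurableType d) n (f : T -> 'rV[R]_n) :
  (forall i, measurable_fun [set: T] (fun t => f t ord0 i)) ->
  measurable_fun [set: T] f.
Proof.
move=> mf _ A mA; rewrite setTI.
suff H : @measurable _ 'rV[R]_n `<=` image_set_system [set: T] f measurable.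
  by have := H _ mA; rewrite /image_set_system /= setTI.
apply: smallest_sub.
  by apply: sigma_algebra_image; exact: sigma_algebra_measurable.
move=> B; rewrite -bigcup_seq/= => -[i _ [C mC <-]].
rewrite /image_set_system /= !setTI.
by have := mf i measurableT C mC; rewrite setTI.
Qed.

Definition rcons_rV n (vt : 'rV[R]_n * R) : 'rV[R]_n.+1 :=
  \row_i oapp (vt.1 ord0) vt.2 (unlift ord_max i).

Lemma measurable_rcons_rV n : measurable_fun setT (@rcons_rV n).
Proof.
apply: measurable_fun_coorP => i; rewrite /rcons_rV.
case: (unliftP ord_max i) => [j|] ->.
- rewrite (_ : (fun _ => _) = (fun x : 'rV[R]_n => x ord0 j) \o fst).
    by apply: measurableT_comp => //; exact: measurable_coor.
  by apply/funext => t; rewrite mxE liftK.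
- rewrite (_ : (fun _ => _) = snd) //.
  by apply/funext => t; rewrite mxE unlift_none.
Qed.

Section step.
Variables (n : nat) (m : {measure set 'rV[R]_n -> \bar R}).

Definition lebesgue_step : set 'rV[R]_n.+1 -> \bar R :=
  pushforward (m \x lebesgue_measure)%E (@rcons_rV n).

Let mpre A : measurable A -> measurable (@rcons_rV n @^-1` A).
Proof.
by move=> mA; rewrite -[X in measurable X]setTI; exact: measurable_rcons_rV.
Qed.

Let step0 : lebesgue_step set0 = 0%E.
Proof. by rewrite /lebesgue_step /pushforward preimage_set0 measure0. Qed.

Let step_ge0 A : (0 <= lebesgue_step A)%E.
Proof. by rewrite /lebesgue_step /pushforward; exact: measure_ge0. Qed.

Let step_sigma_additive : semi_sigma_additive lebesgue_step.
Proof.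
move=> F mF tF mUF; rewrite /lebesgue_step /pushforward preimage_bigcup.
apply: measure_semi_sigma_additive.
- by move=> k; exact: mpre.
- apply/trivIsetP => /= i j _ _ ij; rewrite -preimage_setI.
  by move/trivIsetP : tF => /(_ _ _ _ _ ij) ->//; rewrite preimage_set0.
- by rewrite -preimage_bigcup; exact: mpre.
Qed.

HB.instance Definition _ := isMeasure.Build _ _ _
  lebesgue_step step0 step_ge0 step_sigma_additive.

End step.

(* Lebesgue measure on R^n, as an iterated product of the one on R. *)
Fixpoint lebesgue_rV (n : nat) : {measure set 'rV[R]_n -> \bar R} :=
  if n is k.+1 then lebesgue_step (lebesgue_rV k) else \d_(0 : 'rV[R]_0).

Lemma lebesgue_rV_box n (A : 'I_n -> set R) : (forall i, measurable (A i)) ->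
  lebesgue_rV n [set x | forall i, A i (x ord0 i)] =
  (\prod_(i < n) lebesgue_measure (A i))%E.
Proof.
elim: n A => [|n IH] A mA.
  rewrite big_ord0 /= diracE mem_set //=.
  by case.
set B := [set x : 'rV[R]_n | forall i, A (widen_ord (leqnSn n) i) (x ord0 i)].
have mB : measurable B.
  rewrite (_ : B = \bigcap_(i in setT)
     ((fun x : 'rV[R]_n => x ord0 i) @^-1` (A (widen_ord (leqnSn n) i)))).
    apply: fin_bigcap_measurable => // i _.
    by rewrite -[X in measurable X]setTI; exact: measurable_coor.
  by apply/seteqP; split => x /= H i; [move=> _|]; exact: H.
transitivity ((lebesgue_rV n \x lebesgue_measure)%E (B `*` A ord_max)).
  rewrite /lebesgue_step /pushforward; congr (product_measure1 _ _ _).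
  apply/seteqP; split => -[x t] /=; rewrite /rcons_rV/=.
    move=> H; split => [i|]/=.
      have := H (widen_ord (leqnSn n) i); rewrite mxE.
      rewrite (_ : widen_ord _ i = lift ord_max i) ?liftK//.
      by apply: ord_inj; rewrite lift_max.
    by have := H ord_max; rewrite mxE unlift_none.
  move=> [Hx Ht] i; rewrite mxE; case: (unliftP ord_max i) => [j|] -> //=.
  rewrite (_ : lift ord_max j = widen_ord (leqnSn n) j) //.
  by apply: ord_inj; rewrite lift_max.
rewrite product_measure1E//; last exact: mA.
rewrite [RHS]big_ord_recr /= -IH// => i; exact: mA.
Qed.

End lebesgue_rV.

Section euclidean.
Context {R : realType} {d : nat}.
Implicit Types x y : 'rV[R]_d.

Definition dot x y : R := \sum_i x ord0 i * y ord0 i.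

(* The library norm `|x| on 'rV[R]_d is the sup norm. *)
Definition enorm x : R := Num.sqrt (dot x x).

Definition eball x (r : R) : set 'rV[R]_d := [set y | enorm (y - x) < r].

Definition translate (A : set 'rV[R]_d) (v : 'rV[R]_d) : set 'rV[R]_d :=
  [set x + v | x in A].

Definition symdiff (A B : set 'rV[R]_d) : set 'rV[R]_d :=
  (A `\` B) `|` (B `\` A).

Definition ae_ball (A : set 'rV[R]_d) : Prop :=
  exists c : 'rV[R]_d, exists2 r : R, 0 < r &
    lebesgue_rV d (symdiff A (eball c r)) = 0%E.

Definition partial (V : normedModType R) (i : 'I_d) (f : 'rV[R]_d -> V) :
    'rV[R]_d -> V :=
  fun x => 'D_(delta_mx ord0 i) f x.

Definition gradient (f : 'rV[R]_d -> R) (x : 'rV[R]_d) : 'rV[R]_d :=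
  \row_i partial i f x.

Definition divergence (phi : 'rV[R]_d -> 'rV[R]_d) (x : 'rV[R]_d) : R :=
  \sum_i partial i phi x ord0 i.

Definition C1c_field (phi : 'rV[R]_d -> 'rV[R]_d) : Prop :=
  [/\ forall x, differentiable phi x,
      forall i, continuous (partial i phi) &
      compact (closure [set x | phi x != 0])].

End euclidean.

Section perimeter.
Context {R : realType} {d : nat}.
Implicit Types (E : set 'rV[R]_d) (x nu : 'rV[R]_d).
Let mu := @lebesgue_rV R d.

Definition perimeter E : \bar R :=
  ereal_sup [set (\int[mu]_(x in E) (divergence phi x)%:E)%E |
    phi in [set phi : 'rV[R]_d -> 'rV[R]_d |
            C1c_field phi /\ forall x, enorm (phi x) <= 1]].

(* Polar decomposition - D\chi_E = sigma |D\chi_E|, with tv = |D\chi_E|. *)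
Definition gauss_green E (tv : {finite_measure set 'rV[R]_d -> \bar R})
    (sigma : 'rV[R]_d -> 'rV[R]_d) : Prop :=
  [/\ measurable_fun setT sigma,
      forall x, enorm (sigma x) = 1 &
      forall phi, C1c_field phi ->
        (\int[mu]_(x in E) (divergence phi x)%:E =
         \int[tv]_x (dot (phi x) (sigma x))%:E)%E].

Definition is_outer_normal E x nu : Prop :=
  exists tv : {finite_measure set 'rV[R]_d -> \bar R},
  exists sigma : 'rV[R]_d -> 'rV[R]_d,
  [/\ gauss_green E tv sigma,
      forall r : R, 0 < r -> (0 < tv (eball x r))%E,
      forall i, (\int[tv]_(y in eball x r) sigma y ord0 i) /
                  fine (tv (eball x r)) @[r --> 0^'+] --> nu ord0 i &
      enorm nu = 1].

Definition reduced_boundary E : set 'rV[R]_d :=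
  [set x | exists nu, is_outer_normal E x nu].

Definition outer_normal E x : 'rV[R]_d := xget 0 [set nu | is_outer_normal E x nu].

End perimeter.

Section surfaces.
Context {R : realType} {d : nat}.
Implicit Types (S : set 'rV[R]_d) (x : 'rV[R]_d).

Definition C1a_function (a : R) (f : 'rV[R]_d -> R) : Prop :=
  (forall x, differentiable f x) /\
  exists C : R, forall x y,
    enorm (gradient f x - gradient f y) <= C * enorm (x - y) `^ a.

(* Near each of its points, S is a graph over a hyperplane e^\perp; only the
   values of f on e^\perp matter. *)
Definition C1a_surface (a : R) S : Prop :=
  forall x0, S x0 ->
  exists (e : 'rV[R]_d) (f : 'rV[R]_d -> R) (r : R),
  [/\ enorm e = 1, C1a_function a f, 0 < r &
      S `&` eball x0 r =
      [set x | dot e (x - x0) = f (x - x0 - dot e (x - x0) *: e)]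
        `&` eball x0 r].

(* tau is the gradient of psi along S, S having unit normal nu. *)
Definition is_tangential_gradient S (nu : 'rV[R]_d -> 'rV[R]_d)
    (psi : 'rV[R]_d -> R) (tau : 'rV[R]_d -> 'rV[R]_d) : Prop :=
  forall x, S x -> dot (tau x) (nu x) = 0 /\
    forall eps : R, 0 < eps -> exists2 del : R, 0 < del &
      forall y, S y -> enorm (y - x) < del ->
        `|psi y - psi x - dot (tau x) (y - x)| <= eps * enorm (y - x).

(* The C^{1,a}(S) norm of a function psi with tangential gradient tau. On the
   diagonal the Hoelder quotient is 0 / 0 = 0. *)
Definition C1a_norm (a : R) S (psi : 'rV[R]_d -> R)
    (tau : 'rV[R]_d -> 'rV[R]_d) : \bar R :=
  (ereal_sup [set `|psi x|%:E | x in S] +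
   ereal_sup [set (enorm (tau x))%:E | x in S] +
   ereal_sup [set (enorm (tau x - tau y) / enorm (x - y) `^ a)%:E
             | x in S & y in S])%E.

Definition C1a_graph_cvg (a : R) (Sn : nat -> set 'rV[R]_d)
    (E : set 'rV[R]_d) : Prop :=
  let S := reduced_boundary E in
  let nu := outer_normal E in
  exists (psi : nat -> 'rV[R]_d -> R) (tau : nat -> 'rV[R]_d -> 'rV[R]_d),
  [/\ \forall n \near \oo, Sn n = [set x + psi n x *: nu x | x in S],
      \forall n \near \oo, is_tangential_gradient S nu (psi n) (tau n) &
      C1a_norm a S (psi n) (tau n) @[n --> \oo] --> 0%E].

End surfaces.

Section energies.
Context {R : realType} {d : nat}.
Implicit Types (p s Z : R) (Omega : set 'rV[R]_d) (m : R).
Let mu := @lebesgue_rV R d.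

(* Since 0^-1 = 0, the kernels vanish instead of being infinite at 0; this only
   concerns null sets. *)
Definition riesz s Omega : \bar R :=
  (\int[mu]_(x in Omega) \int[mu]_(y in Omega)
     ((enorm (x - y) `^ s)^-1)%:E)%E.

Definition attraction p Omega : \bar R :=
  (\int[mu]_(x in Omega) ((enorm x `^ p)^-1)%:E)%E.

Definition energy0 s Omega : \bar R := (perimeter Omega + riesz s Omega)%E.

Definition energy p s Z Omega : \bar R :=
  (energy0 s Omega - Z%:E * attraction p Omega)%E.

Lemma energyZ0 p s Omega : energy p s 0 Omega = energy0 s Omega.
Proof. by rewrite /energy mul0e sube0. Qed.

Definition min_energy (F : set 'rV[R]_d -> \bar R) m : \bar R :=
  ereal_inf [set F Omega | Omega in
    [set Omega | measurable Omega /\ mu Omega = m%:E]].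

Definition minimizer (F : set 'rV[R]_d -> \bar R) m Omega : Prop :=
  [/\ measurable Omega, mu Omega = m%:E & F Omega = min_energy F m].

End energies.

(* The defining property of the critical exponent of Bonacini and Cristoferi,
   within the range s < d where the Riesz energy is finite. *)
Definition critical_exponent (R : realType) (d : nat) (sbar : R) : Prop :=
  0 < sbar /\
  forall s : R, 0 < s -> s < sbar -> s < d%:R ->
  forall (m : R) (Omega : set 'rV[R]_d), 0 < m ->
    minimizer (energy0 s) m Omega -> ae_ball Omega.

Section concentration.
Context {R : realType} {d N : nat}.
Implicit Types (p s : R) (m : 'I_N.+1 -> R) (y : 'I_N.+1 -> 'rV[R]_d).

Definition point_energy p s m y : \bar R :=
  if [exists i, exists j, (i != j) && (y i == y j)] then +oo%E else
  (\sum_i \sum_(j | j != i) m i * m j / enorm (y i - y j) `^ s -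
   \sum_(i | i != ord0) m i / enorm (y i) `^ p)%:E.

Definition point_minimizer p s m y : Prop :=
  y ord0 = 0 /\
  forall y', y' ord0 = 0 -> (point_energy p s m y <= point_energy p s m y')%E.

Definition compact_alternative s (M : R) (Omega : nat -> set 'rV[R]_d)
    m (E : 'I_N.+1 -> set 'rV[R]_d) : Prop :=
  [/\ N = 0%N, m ord0 = M, minimizer (energy0 s) M (E ord0) &
      (\int[lebesgue_rV d]_x `|\1_(Omega n) x - \1_(E ord0) x|%:E)%E
        @[n --> \oo] --> 0%E].

Definition splitting_alternative p s (M : R) (Z : nat -> R)
    (Omega : nat -> set 'rV[R]_d) m (E : 'I_N.+1 -> set 'rV[R]_d) : Prop :=
  [/\ (1 <= N)%N,
      forall i, 0 < m i,
      \sum_i m i = M,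
      forall i, [/\ compact (E i), (perimeter (E i) < +oo)%E &
                    lebesgue_rV d (E i) = (m i)%:E] &
  exists x : nat -> 'I_N.+1 -> 'rV[R]_d,
  [/\ [/\ forall n, x n ord0 = 0,
          forall i, i != ord0 -> enorm (x n i) @[n --> \oo] --> +oo &
          forall i j, i != j -> enorm (x n i - x n j) @[n --> \oo] --> +oo],
      (forall n, C1a_surface (1 / 2) (reduced_boundary (Omega n))) /\
      (exists rho : R,
        [/\ 0 < rho, forall i, E i `<=` eball 0 rho &
            forall i (a : R), 0 < a -> a < 1 / 2 ->
              C1a_graph_cvg a
                (fun n => translate (reduced_boundary (Omega n)) (- x n i)
                            `&` eball 0 rho) (E i)]),
      lebesgue_rV d (symdiff (Omega n)
          (E ord0 `|` \bigcup_(i in [set~ ord0]) translate (E i) (x n i)))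
        @[n --> \oo] --> 0%E,
      forall i, min_energy (@energy0 R d s) (m i) = energy0 s (E i) &
      exists2 y : 'I_N.+1 -> 'rV[R]_d,
        forall i, i != ord0 -> Z n `^ (1 / (s - p)) *: x n i @[n --> \oo] --> y i &
        point_minimizer p s m y]].

End concentration.

(* Main.v *)
Require Import Defs.
From HB Require Import structures.
From mathcomp Require Import all_boot all_order all_algebra.
From mathcomp Require Import all_classical all_reals all_analysis measurable_realfun.
From mathcomp Require Import ring lra.
Import Order.TTheory GRing.Theory Num.Theory.
Import numFieldTopology.Exports numFieldNormedType.Exports.
Local Open Scope classical_set_scope.
Local Open Scope ring_scope.
Set Implicit Arguments.
Unset Strict Implicit.
Unset Printing Implicit Defensive.

(** When there is a single piece, it minimizes E_0 at mass M, so it is a ball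
by the defining property of the critical exponent. When the minimizers split,
every E^i still minimizes E_0 at its own mass m^i and is a ball for the same
reason. What remains is that the masses are equal, and this follows from
energy comparison alone.

Let f (u) = P u^(1 - 1/d) + Q u^(2 - s/d) be the energy of a ball whose volume
is u times that of the unit ball, P and Q being the perimeter and the Riesz
energy of the unit ball ([ball_energy]). The masses minimize the sum of the
f (u_i) under the constraint that the total is M:

- From above, the minimality of Omega_n can be tested against a union of balls
of arbitrary volumes w_i with the right total. Put far apart, these balls have
an energy that exceeds the sum of the f (w_i) by as little as desired
([scattered_balls]).

- From below, vector fields that almost realize the perimeters of the E^i,
carried to the points x_n^i, have disjoint supports, so their sum is a test
field for the perimeter of Omega_n. As the symmetric difference of Omega_n
with the union of the translated E^i is small, it gives almost the sum of the
perimeters ([separated_perimeter_ge]). The Riesz energy of Omega_n is at least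
the sum of those of its disjoint parts Omega_n `&` (E^i + x_n^i)
([separated_riesz_le]), and removing a small set changes a Riesz energy
little, because the potential of a set of finite measure is bounded
([potential_bound]).

- The attraction term is Z_n times a bounded quantity, as |x|^(-p) is locally
integrable, and bounded away from the origin ([attraction_bound]).

Changing two masses only, each pair (u_i, u_j) minimizes t |-> f t + f (u_i +
u_j - t). The function f is concave and then convex, so the vanishing of the
first derivative does not decide; but at a critical point with unequal
entries the second derivative is negative ([minimizing_pair_equal]), which is
an inequality between powers ([powR_competition]). *)

(** * A strict inequality for pairs of masses *)

Section calculus.
Context {R : realType}.
Implicit Types (f g : R -> R) (a b c l x y : R).

(** If l were negative, g would be negative just to the right of its zero c, so f
would decrease there. *)
Lemma second_derivative_at_min f g a b c l : c \in `]a, b[ ->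
  (forall x, x \in `]a, b[ -> is_derive x 1 f (g x)) -> is_derive c 1 g l ->
  (forall x, x \in `]a, b[ -> f c <= f x) -> g c = 0 /\ 0 <= l.
Proof.
move=> cab df dg fmin.
have ab : a < b by move: cab; rewrite in_itv/= => /andP[]; exact: lt_trans.
have gc0 : g c = 0.
  have := @derive1_at_min R f a b c (ltW ab) (fun t h => @ex_derive _ _ _ _ _ _ _ (df t h)) cab fmin.
  by move=> h; rewrite -(@derive_val _ _ _ _ _ _ _ (df c cab)) (@derive_val _ _ _ _ _ _ _ h).
split => //; rewrite leNgt; apply/negP => l0.
have /cvgrPdist_lt /(_ (- l)) : h^-1 *: (g (h *: 1 + c) - g c) @[h --> 0^'] --> l.
  by have [? <-] := dg.
rewrite oppr_gt0 => /(_ l0) /nbhs_ballP[e /= e0 eg].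
have gneg x : c < x -> x < c + e -> g x < 0.
  move=> cx xce.
  have xc0 : x - c != 0 by rewrite subr_eq0 gt_eqF.
  have := eg (x - c); rewrite /ball_ /= => eg'.
  have {}eg' : `|l - (x - c)^-1 *: (g ((x - c)%:A + c) - g c)| < - l.
    by apply: eg' => //; rewrite /ball/= sub0r normrN gtr0_norm ?subr_gt0// ltrBlDl.
  have {}h : (x - c)^-1 * g x < 0.
    move: eg'; rewrite distrC gc0 subr0 /GRing.scale /= mulr1 subrK => /ltr_normlW.
    lra.
  by move: h; rewrite pmulr_rlt0// invr_gt0 subr_gt0.
(* A point to the right of c, within reach of gneg and inside ]a, b[. *)
pose h := Num.min (e / 2) ((b - c) / 2).
have [ac cb] : a < c /\ c < b by move: cab; rewrite in_itv/= => /andP.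
have h0 : 0 < h by rewrite lt_min !divr_gt0// subr_gt0.
have he : h < e by rewrite gt_min; apply/orP; left; lra.
have hb : c + h < b by rewrite -ltrBrDl gt_min; apply/orP; right; lra.
have inab x : x \in `[c, c + h] -> x \in `]a, b[.
  by rewrite !in_itv/= => /andP[? ?]; apply/andP; split; lra.
have cch : c < c + h by rewrite ltrDl.
have [|z zch] := @MVT R f g c (c + h) cch (fun x xh => df x (inab _ (subset_itv_oo_cc xh))).
  apply: derivable_within_continuous => x /inab xab.
  exact: (@ex_derive _ _ _ _ _ _ _ (df x xab)).
have := fmin (c + h) (inab _ _); rewrite in_itv/= ltW//= lexx => /(_ isT) fch.
move: zch; rewrite in_itv/= => /andP[cz zch].
have gz : g z < 0 by apply: gneg => //; lra.
rewrite addrAC subrr add0r => E.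
have : f (c + h) - f c < 0 by rewrite E nmulr_rlt0.
by rewrite subr_lt0 ltNge fch.
Qed.

End calculus.

Section logarithm.
Context {R : realType}.
Implicit Types x : R.

Lemma ge_value_at1 (f g : R -> R) : (forall x, 1 < x -> is_derive x 1 f (g x)) ->
  is_derive (1:R) (1:R) f (g 1) ->
  (forall x, 1 < x -> 0 <= g x) -> forall x, 1 < x -> f 1 <= f x.
Proof.
move=> df df1 g0 x x1.
have [||z] := @MVT R f g 1 x x1.
- by move=> z; rewrite in_itv/= => /andP[? _]; exact: df.
- apply: derivable_within_continuous => z; rewrite in_itv/= => /andP[].
  rewrite le_eqVlt => /predU1P[<- _|z1 _]; first exact: (@ex_derive _ _ _ _ _ _ _ df1).
  exact: (@ex_derive _ _ _ _ _ _ _ (df z z1)).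
rewrite in_itv/= => /andP[z1 _] E; rewrite -subr_ge0 E mulr_ge0 ?g0// subr_ge0; exact: ltW.
Qed.

Lemma ln_le_subr1 x : 0 < x -> ln x <= x - 1.
Proof.
move=> x0; have := @le_ln1Dx R (x - 1); rewrite addrCA subrr addr0; apply.
by rewrite ltrBrDl subrr.
Qed.

(** Near 1 the two sides agree to second order. The derivative of the difference
is ln x + 1/x - 1. With x = exp (2 z) this is tanh z <= z. *)
Lemma ln_ge_pade x : 1 < x -> 2 * (x - 1) <= (x + 1) * ln x.
Proof.
move=> x1; rewrite -subr_ge0.
have D (y : R) : 0 < y -> is_derive y 1
    (fun y => (y + 1) * ln y - 2 * (y - 1)) (ln y + y^-1 - 1).
  move=> y0; have := is_derive1_ln y0 => H.
  apply: is_derive_eq.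
  rewrite /GRing.scale /= !addr0 oppr0 addr0 !mulr1 mulrDl mulfV ?gt_eqF//; lra.
have := @ge_value_at1 _ _ (fun y y1 => D y (lt_trans ltr01 y1)) (D 1 ltr01) _ x x1.
rewrite /= ln1 subrr !mulr0 subrr; apply=> y y1.
have y0 : 0 < y by lra.
have := @ln_le_subr1 y^-1; rewrite invr_gt0 lnV// => /(_ y0); lra.
Qed.

(** The derivative of the difference is 2 (x - 1 - ln x). With x = exp z this is
z <= sinh z. *)
Lemma ln_le_sub_inv x : 1 < x -> 2 * (x * ln x) <= x ^+ 2 - 1.
Proof.
move=> x1; rewrite -subr_ge0.
have D (y : R) : 0 < y -> is_derive y 1
    (fun y => y ^+ 2 - 1 - 2 * (y * ln y)) (2 * (y - 1 - ln y)).
  move=> y0; have := is_derive1_ln y0 => H.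
  apply: is_derive_eq.
  rewrite /GRing.scale /= oppr0 addr0 !mulr1 mulfV ?gt_eqF//=; lra.
have := @ge_value_at1 _ _ (fun y y1 => D y (lt_trans ltr01 y1)) (D 1 ltr01) _ x x1.
rewrite /= ln1 expr1n !mulr0 subrr subr0; apply=> y y1.
have y0 : 0 < y by lra.
have := @ln_le_subr1 y y0; lra.
Qed.

End logarithm.

Section pair_of_masses.
Context {R : realType}.

Lemma powR_above1 (u e : R) : 1 < u -> 0 < e -> 1 < u `^ e.
Proof.
move=> u1 e0; rewrite -[ltLHS](congr1 (@^~ e) (@powR1 R)).
by apply: gt0_ltr_powR => //; rewrite nnegrE; lra.
Qed.

(** With u = exp (2 x), dividing by exp x (u `^ de - 1) (u `^ ga - 1) turns this
into
  ga (cosh x coth (ga x) - sinh x) < de (cosh x coth (de x) + sinh x).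
It follows from 1 <= x de coth (de x), which is [ln_ge_pade] at u `^ de, and
from ga coth (ga x) <= 1 / x + ga tanh (ga x) <= 1 / x + ga tanh x, whose first
half is [ln_le_sub_inv] at u `^ ga and whose second half is u `^ ga <= u. *)
Lemma powR_competition (de ga u : R) : 0 < de -> 0 < ga -> ga < 1 -> 1 < u ->
  ga * (u + u `^ ga) * (u `^ de - 1) < de * (u `^ de * u + 1) * (u `^ ga - 1).
Proof.
move=> de0 ga0 ga1 u1.
have u0 : 0 < u by lra.
set X := u `^ de; set Y := u `^ ga; set l := ln u.
have X1 : 1 < X by exact: powR_above1.
have Y1 : 1 < Y by exact: powR_above1.
have Yu : Y < u.
  have E : Y * u `^ (1 - ga) = u.
    rewrite /Y -powRD; last by apply/implyP => _; rewrite gt_eqF.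
    by rewrite addrCA subrr addr0 powRr1 // ltW.
  rewrite -[X in _ < X]E ltr_pMr; last lra.
  by apply: powR_above1; lra.
have l0 : 0 < l by rewrite ln_gt0.
have := ln_ge_pade X1; rewrite ln_powR -/l => HX.
have := ln_le_sub_inv Y1; rewrite ln_powR -/l => HY.
rewrite -(ltr_pM2l l0).
(* 2 (X u + 1) = (X + 1) (u + 1) + (X - 1) (u - 1), and
   2 (u + Y) = (Y + 1) (u + 1) - (Y - 1) (u - 1): the addition formulas of cosh.
   Both sides are then compared with (Y - 1) (X - 1) (u + 1). *)
have E1 : l * (de * (X * u + 1) * (Y - 1)) =
  ((Y - 1) / 2) * (((X + 1) * (de * l)) * (u + 1) + de * l * (X - 1) * (u - 1)) by field.
have E2 : l * (ga * (u + Y) * (X - 1)) =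
  ((X - 1) / 2) * (ga * l * (Y + 1) * (u + 1) - ga * l * (Y - 1) * (u - 1)) by field.
rewrite E1 E2.
have A1 : (Y - 1) * (X - 1) * (u + 1) < ((Y - 1) / 2) * (((X + 1) * (de * l)) * (u + 1) + de * l * (X - 1) * (u - 1)).
  have -> : (Y - 1) * (X - 1) * (u + 1) = (Y - 1) / 2 * (2 * (X - 1) * (u + 1)) by field.
  rewrite ltr_pM2l; last lra.
  have : 0 < de * l * (X - 1) * (u - 1) by rewrite !mulr_gt0//; lra.
  have : 2 * (X - 1) * (u + 1) <= (X + 1) * (de * l) * (u + 1) by rewrite ler_pM2r//; lra.
  lra.
apply: le_lt_trans A1.
have -> : (Y - 1) * (X - 1) * (u + 1) = (X - 1) / 2 * (2 * (Y - 1) * (u + 1)) by field.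
rewrite ler_pM2l; last lra.
rewrite -(@ler_pM2l _ (Y + 1)); last lra.
have -> : (Y + 1) * (ga * l * (Y + 1) * (u + 1) - ga * l * (Y - 1) * (u - 1)) =
  2 * (2 * (Y * (ga * l))) * (u + 1) - (ga * l * (Y - 1)) * ((Y + 1) * (u - 1) - (Y - 1) * (u + 1)) by ring.
have -> : (Y + 1) * (2 * (Y - 1) * (u + 1)) = 2 * (Y ^+ 2 - 1) * (u + 1) by ring.
have : 2 * (2 * (Y * (ga * l))) * (u + 1) <= 2 * (Y ^+ 2 - 1) * (u + 1).
  rewrite ler_pM2r; [rewrite ler_pM2l//|]; lra.
have : 0 <= (ga * l * (Y - 1)) * ((Y + 1) * (u - 1) - (Y - 1) * (u + 1)).
  rewrite !mulr_ge0//; lra.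
lra.
Qed.

(** For a < b and u = b / a, write p and q for the derivatives at a of the two
terms of the energy. The first and second order conditions at the minimum
t = a are linear in (p, q); eliminating p / q contradicts [powR_competition]
with exponents 1 - al and be - 1. *)
Lemma minimizing_pair_equal (P Q al be a b : R) : 0 <= P -> 0 < Q ->
  0 < al -> al < 1 -> 1 < be -> be < 2 -> 0 < a -> 0 < b ->
  (forall t : R, 0 < t -> t < a + b ->
    (P * a `^ al + Q * a `^ be) + (P * b `^ al + Q * b `^ be) <=
    (P * t `^ al + Q * t `^ be) + (P * (a + b - t) `^ al + Q * (a + b - t) `^ be)) ->
  a = b.
Proof.
move=> P0 Q0 al0 al1 be1 be2.
wlog suff W : a b / a < b -> 0 < a -> 0 < b -> (forall t : R, 0 < t -> t < a + b ->
    (P * a `^ al + Q * a `^ be) + (P * b `^ al + Q * b `^ be) <=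
    (P * t `^ al + Q * t `^ be) + (P * (a + b - t) `^ al + Q * (a + b - t) `^ be)) -> False.
  move=> a0 b0 H; apply/eqP; rewrite eq_le !leNgt; apply/andP; split; apply/negP => ab.
    apply: (W b a) => // t t0 tab; rewrite addrC [b + a]addrC; apply: H => //; lra.
  by apply: (W a b).
move=> ab a0 b0 H.
pose f (t : R) := P * t `^ al + Q * t `^ be.
pose f' (t : R) := P * (al * t `^ (al - 1)) + Q * (be * t `^ (be - 1)).
pose f'' (t : R) := P * (al * ((al - 1) * (t `^ (al - 1) / t))) + Q * (be * ((be - 1) * (t `^ (be - 1) / t))).
have df (t : R) : 0 < t -> is_derive t 1 f (f' t).
  move=> t0; have H1 := is_derive1_powR al t0; have H2 := is_derive1_powR be t0.
  exact: is_deriveD.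
have df' (t : R) : 0 < t -> is_derive t 1 f' (f'' t).
  move=> t0; have H1 := is_derive1_powR (al - 1) t0; have H2 := is_derive1_powR (be - 1) t0.
  have : is_derive t 1 f' (P * (al * ((al - 1) * t `^ (al - 1 - 1))) + Q * (be * ((be - 1) * t `^ (be - 1 - 1)))).
    apply: is_deriveD.
  have Pw (z : R) : t `^ (z - 1) = t `^ z / t.
    by rewrite powRB ?powRr1 ?(ltW t0)//; apply/implyP => _; rewrite gt_eqF.
  by rewrite (Pw (al - 1)) (Pw (be - 1)).
have dsub (g : R -> R) (g' t : R) : is_derive (a + b - t) 1 g g' -> is_derive t 1 (fun t : R => g (a + b - t)) (- g').
  move=> dg; have : is_derive t (1:R) (fun t : R => a + b - t) (-1).
    by have := is_deriveB (is_derive_cst (a + b : R) t 1) (is_derive_id t 1); rewrite sub0r.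
  move=> ds; have := @is_derive1_comp R g _ t _ _ dg ds.
  by rewrite mulrN1.
have [|t||t|] := @second_derivative_at_min R (fun t : R => f t + f (a + b - t))
    (fun t : R => f' t - f' (a + b - t)) 0 (a + b) a (f'' a + f'' b).
- by rewrite in_itv/= a0 ltrDl.
- rewrite in_itv/= => /andP[t0 tab].
  by apply: is_deriveD; [exact: df|apply: dsub; apply: df; lra].
- have -> : f'' a + f'' b = f'' a - (- f'' b) by rewrite opprK.
  apply: is_deriveB; [exact: df'|apply: dsub].
  by rewrite addrAC subrr add0r; exact: df'.
- rewrite in_itv/= => /andP[t0 tab].
  by rewrite (_ : a + b - a = b); [exact: H|lra].
rewrite (_ : a + b - a = b); last lra.
pose u := b / a; pose X := u `^ (1 - al); pose Y := u `^ (be - 1).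
have u1 : 1 < u by rewrite ltr_pdivlMr// mul1r.
have u0 : 0 < u by lra.
have Eb : b = a * u by rewrite /u; field; rewrite gt_eqF.
have X0 : 0 < X by exact: powR_gt0.
have Y0 : 0 < Y by exact: powR_gt0.
have EX : b `^ (al - 1) = a `^ (al - 1) / X.
  by rewrite Eb powRM ?(ltW a0) ?(ltW u0)// /X -powRN opprB.
have EY : b `^ (be - 1) = a `^ (be - 1) * Y by rewrite Eb powRM ?(ltW a0) ?(ltW u0).
rewrite /f' /f'' EX EY.
pose p := P * al * a `^ (al - 1); pose q := Q * be * a `^ (be - 1).
have q0 : 0 < q by rewrite !mulr_gt0 ?powR_gt0//; lra.
move=> H1 H2.
have {}H1 : p * (X - 1) = q * (Y - 1) * X.
  have -> : p * (X - 1) = q * (Y - 1) * X + X * (P * (al * a `^ (al - 1)) + Q * (be * a `^ (be - 1)) - (P * (al * (a `^ (al - 1) / X)) + Q * (be * (a `^ (be - 1) * Y)))).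
    by rewrite /p /q; field; rewrite gt_eqF.
  by rewrite H1 mulr0 addr0.
have {}H2 : (1 - al) * p * (X * u + 1) <= (be - 1) * q * X * (u + Y).
  have aXu0 : 0 < a * X * u by do 2 apply: mulr_gt0 => //.
  rewrite -subr_ge0; move: (mulr_ge0 (ltW aXu0) H2); rewrite {}Eb.
  congr (_ <= _); rewrite /p /q; field.
  by rewrite !gt_eqF.
have X1 : 0 < X - 1.
  by rewrite subr_gt0; apply: powR_above1 => //; lra.
have := @powR_competition (1 - al) (be - 1) u; rewrite -/X -/Y => K.
have {}K : (be - 1) * (u + Y) * (X - 1) < (1 - al) * (X * u + 1) * (Y - 1) by apply: K; lra.
have : (1 - al) * (q * (Y - 1) * X) * (X * u + 1) <= (be - 1) * q * X * (u + Y) * (X - 1).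
  rewrite -H1; have -> : (1 - al) * (p * (X - 1)) * (X * u + 1) = (1 - al) * p * (X * u + 1) * (X - 1) by ring.
  by rewrite ler_pM2r.
have -> : (1 - al) * (q * (Y - 1) * X) * (X * u + 1) = q * X * ((1 - al) * (X * u + 1) * (Y - 1)) by ring.
have -> : (be - 1) * q * X * (u + Y) * (X - 1) = q * X * ((be - 1) * (u + Y) * (X - 1)) by ring.
have qX0 : 0 < q * X by exact: mulr_gt0.
by rewrite (ler_pM2l qX0) leNgt K.
Qed.

End pair_of_masses.

(** * Borel sets and Lebesgue measure of R^d *)

Section borel.
Context {R : realType} {d : nat}.
Implicit Types (A U K : set 'rV[R]_d) (x y v : 'rV[R]_d) (a b : 'I_d -> R).

Lemma coord_le_norm x i : `|x ord0 i| <= `|x|.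
Proof.
rewrite [leRHS]/Num.norm /= mx_normrE; apply/bigmax_geP; right => /=.
by exists (ord0, i).
Qed.

Lemma norm_ltP x (e : R) : 0 < e -> (forall i, `|x ord0 i| < e) -> `|x| < e.
Proof.
move=> e0 H; rewrite [ltLHS]/Num.norm /= mx_normrE; apply/bigmax_ltP => /=.
by split => // -[i j] _ /=; rewrite (ord1 i).
Qed.

Definition box a b : set 'rV[R]_d :=
  [set x | forall i, (`]a i, b i]%classic : set R) (x ord0 i)].

Lemma boxI a b a' b' :
  box a b `&` box a' b' = box (fun i => Num.max (a i) (a' i)) (fun i => Num.min (b i) (b' i)).
Proof.
apply/seteqP; split => x /=.
  move=> [H H'] i; move: (H i) (H' i); rewrite /= !in_itv/= => /andP[h1 h2] /andP[h3 h4].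
  by rewrite gt_max le_min h1 h2 h3 h4.
by move=> H; split => i; have := H i; rewrite /= !in_itv/= gt_max le_min
  => /andP[/andP[h1 h2] /andP[h3 h4]]; rewrite ?h1 ?h2 ?h3 ?h4.
Qed.

Lemma measurable_coord_preimage (B : 'I_d -> set R) :
  (forall i, measurable (B i)) -> measurable [set x : 'rV[R]_d | forall i, B i (x ord0 i)].
Proof.
move=> mB; rewrite (_ : mkset _ = \bigcap_(i in setT)
     ((fun x : 'rV[R]_d => x ord0 i) @^-1` (B i))).
  apply: fin_bigcap_measurable => // i _.
  by rewrite -[X in measurable X]setTI; exact: measurable_coor.
by apply/seteqP; split => x /= H i; [move=> _|]; exact: H.
Qed.

Lemma bigcup_box : \bigcup_(k : nat) box (fun=> - k%:R) (fun=> k%:R) = setT.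
Proof.
apply/seteqP; split => // x _; exists (Num.truncn `|x|).+1 => // i.
rewrite /= in_itv/=.
have : `|x ord0 i| < (Num.truncn `|x|).+1%:R.
  by apply: le_lt_trans (coord_le_norm x i) _; exact: truncnS_gt.
by rewrite ltr_norml => /andP[-> /ltW].
Qed.

Lemma measurable_box a b : measurable (box a b).
Proof.
apply: (@measurable_coord_preimage (fun i => `]a i, b i]%classic)) => i.
exact: measurable_itv.
Qed.

(** The preimage of ]a, b] under a coordinate is the increasing union of the boxes
whose other sides are ]-k, k]. *)
Lemma measurable_rV_boxE :
  @measurable _ 'rV[R]_d = <<s [set A | exists a b, A = box a b] >>.
Proof.
apply/seteqP; split; last first.
  apply: smallest_sub; first exact: sigma_algebra_measurable.
  by move=> _ [a [b ->]]; exact: measurable_box.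
set G := [set A | _].
apply: smallest_sub; first exact: smallest_sigma_algebra.
move=> B; rewrite -bigcup_seq/= => -[i _ [C mC <-]]; rewrite setTI.
suff H : @measurable _ R `<=` image_set_system [set: 'rV[R]_d] (fun x => x ord0 i) <<s G >>.
  by have := H _ mC; rewrite /image_set_system /= setTI.
apply: smallest_sub.
  by apply: sigma_algebra_image; exact: smallest_sigma_algebra.
move=> _ [[a b] _ <-]; rewrite /image_set_system /= setTI.
rewrite (_ : _ @^-1` _ = \bigcup_(k : nat) box (fun j => if j == i then a else - k%:R)
   (fun j => if j == i then b else k%:R)).
  apply: sigma_algebra_bigcup => k; apply: sub_sigma_algebra.
  by eexists; eexists; reflexivity.
apply/seteqP; split => x /=.
  move=> xi; have : [set: 'rV[R]_d] x by [].
  rewrite -bigcup_box => -[k _ kx]; exists k => // j /=.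
  by have [->|ji] := eqVneq j i => //; exact: kx.
by move=> [k _ /(_ i)]; rewrite /= eqxx.
Qed.

Lemma lebesgue_rV_boxE a b :
  lebesgue_rV d (box a b) = (\prod_(i < d) lebesgue_measure (`]a i, b i]%classic : set R))%E.
Proof.
apply: (@lebesgue_rV_box R d (fun i => `]a i, b i]%classic)) => i.
exact: measurable_itv.
Qed.

(** Boxes form a pi-system that generates the Borel sets and contains an
exhaustion by sets of finite measure. *)
Lemma lebesgue_rV_unique (m : {measure set 'rV[R]_d -> \bar R}) (c : R) : 0 <= c ->
  (forall a b, m (box a b) = (c%:E * lebesgue_rV d (box a b))%E) ->
  forall A, measurable A -> m A = (c%:E * lebesgue_rV d A)%E.
Proof.
move=> c0 H A mA.
have Hm := @measure_unique _ R _ [set A | exists a b, A = box a b]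
  (fun k => box (fun=> - k%:R) (fun=> k%:R)) measurable_rV_boxE _ _ bigcup_box m
  (mscale (NngNum c0) (lebesgue_rV d)).
rewrite Hm//.
- by move=> _ _ [a [b ->]] [a' [b' ->]]; rewrite boxI; eexists; eexists.
- by move=> k; eexists; eexists.
- by move=> _ [a [b ->]]; exact: H.
- move=> k; rewrite H -ge0_fin_numE ?mule_ge0// fin_numM//.
  rewrite lebesgue_rV_boxE.
  elim/big_ind : _ => //; first exact: fin_numM.
  by move=> i _; rewrite lebesgue_measure_itv/=; case: ifP => // _; rewrite -EFinB.
Qed.

(** The Borel structure is generated by coordinates. An open set is the union of
the cubes with rational centre and side 2 / (k + 1) that it contains, and
there are countably many of these. *)
Lemma open_measurable_rV U : open U -> measurable U.
Proof.
move=> oU.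
pose B (q : 'rV[rat]_d * nat) : set 'rV[R]_d :=
  [set x | forall i, (ball (ratr (q.1 ord0 i) : R) (q.2.+1%:R^-1) : set R) (x ord0 i)].
rewrite (_ : U = \bigcup_q (if `[< B q `<=` U >] then B q else set0)).
  apply: countable_bigcupT_measurable => // q; case: ifPn => // _.
  apply: (@measurable_coord_preimage (fun i => ball (ratr (q.1 ord0 i) : R) q.2.+1%:R^-1)) => i.
  exact: measurable_ball.
apply/seteqP; split; last by move=> x [q _]; case: asboolP => // + Bqx; apply.
move=> x Ux.
have /nbhs_ballP[e /= e0 xeU] : nbhs x U by exact: open_nbhs_nbhs.
(* The cube is centred within 1 / (k + 1) of x, so its points are within twice
   that distance of x. *)
have [k ke] : exists k : nat, k.+1%:R^-1 + k.+1%:R^-1 < e.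
  have e20 : 0 < e / 2 by rewrite divr_gt0.
  exists (Num.truncn (e / 2)^-1).
  have : (e / 2)^-1 < (Num.truncn (e / 2)^-1).+1%:R by exact: truncnS_gt.
  rewrite invf_plt ?posrE// => h; rewrite [X in _ < X](splitr e); exact: ltrD.
have k0 : 0 < k.+1%:R^-1 :> R by rewrite invr_gt0.
have Q i : exists q : rat, ball (ratr q : R) k.+1%:R^-1 (x ord0 i).
  have /rat_in_itvoo[q] : x ord0 i - k.+1%:R^-1 < x ord0 i + k.+1%:R^-1.
    by rewrite ltrD2l (lt_trans _ k0)// oppr_lt0.
  rewrite in_itv/= => /andP[h1 h2]; exists q.
  rewrite /ball/= ltr_norml; apply/andP.
  by split; [rewrite ltrBrDl; exact: h1|rewrite ltrBlDl; exact: h2].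
have {Q}[q Q] := choice Q.
exists ((\row_i q i, k)) => //.
have Bx : B (\row_i q i, k) x by move=> i; rewrite mxE; exact: Q.
case: asboolP => // -[] y By; apply: xeU; rewrite -ball_normE /=.
apply: norm_ltP => // i; rewrite !mxE.
apply: le_lt_trans ke.
have := By i; have := Bx i; rewrite /ball /= mxE => h1 h2.
rewrite (_ : _ - _ = (x ord0 i - ratr (q i)) + (ratr (q i) - y ord0 i)); last by ring.
by apply: le_trans (ler_normD _ _) _; rewrite lerD// ltW// distrC.
Qed.

Lemma closed_measurable_rV K : closed K -> measurable K.
Proof.
move=> cK; rewrite -(setCK K); apply: measurableC.
by apply: open_measurable_rV; exact: closed_openC.
Qed.

Lemma compact_measurable_rV K : compact K -> measurable K.
Proof.
by move=> cK; apply: closed_measurable_rV; apply: compact_closed => //; exact: norm_hausdorff.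
Qed.

Lemma continuous_measurable_rV (f : 'rV[R]_d -> R) : continuous f -> measurable_fun setT f.
Proof.
move=> /continuousP cf.
apply: (measurability _ (RGenOpens.measurableE R)).
move=> _ [_ [a [b ->] <-]]; rewrite setTI; apply: open_measurable_rV.
by apply: cf; exact: interval_open.
Qed.

End borel.

Section affine.
Context {R : realType} {d : nat}.
Implicit Types (A D E : set 'rV[R]_d) (x y v : 'rV[R]_d).
Let mu := @lebesgue_rV R d.

(** Translations and dilations are treated at once; images are written as
preimages under the inverse map. *)
Definition affine (c : R) v x : 'rV[R]_d := c *: x + v.

Lemma measurable_affine c v : measurable_fun setT (affine c v).
Proof.
apply: measurable_fun_coorP => i; rewrite /affine.
under eq_fun do rewrite !mxE.
apply: measurable_funD => //; apply: measurable_funM => //.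
exact: measurable_coor.
Qed.

Lemma measurable_affine_preimage c v A : measurable A -> measurable (affine c v @^-1` A).
Proof. by move=> mA; rewrite -[X in measurable X]setTI; exact: measurable_affine. Qed.

Definition affine_image_measure (c : R) v : set 'rV[R]_d -> \bar R := pushforward mu (affine c v).

Section instance.
Variables (c : R) (v : 'rV[R]_d).
Let nu := affine_image_measure c v.
Let nu0 : nu set0 = 0%E.
Proof. by rewrite /nu /affine_image_measure /pushforward preimage_set0 measure0. Qed.
Let nu_ge0 A : (0 <= nu A)%E.
Proof. by rewrite /nu /affine_image_measure /pushforward; exact: measure_ge0. Qed.
Let nu_sigma_additive : semi_sigma_additive nu.
Proof.
move=> F mF tF mUF; rewrite /nu /affine_image_measure /pushforward preimage_bigcup.
apply: measure_semi_sigma_additive.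
- by move=> k; exact: measurable_affine_preimage.
- apply/trivIsetP => /= i j _ _ ij; rewrite -preimage_setI.
  by move/trivIsetP : tF => /(_ _ _ _ _ ij) ->//; rewrite preimage_set0.
- by rewrite -preimage_bigcup; exact: measurable_affine_preimage.
Qed.
HB.instance Definition _ := isMeasure.Build _ _ _
  (affine_image_measure c v) nu0 nu_ge0 nu_sigma_additive.
End instance.

(** Both sides are measures in A, and on boxes the identity is the
one-dimensional one in each coordinate. *)
Lemma lebesgue_affine (c : R) v A : 0 < c -> measurable A ->
  mu (affine c v @^-1` A) = (((c ^+ d)^-1)%:E * mu A)%E.
Proof.
move=> c0; apply: (@lebesgue_rV_unique R d (affine_image_measure c v)) => [|a b].
  by rewrite invr_ge0 exprn_ge0// ltW.
rewrite [LHS](_ : _ = mu (affine c v @^-1` (box a b)))//.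
rewrite (_ : affine c v @^-1` (box a b) = box (fun i => (a i - v ord0 i) / c) (fun i => (b i - v ord0 i) / c)); last first.
  apply/seteqP; split => x /= H i; have := H i; rewrite /= /affine !mxE !in_itv/=;
    by rewrite ltr_pdivrMr// ler_pdivlMr// ltrBlDr lerBrDr mulrC.
rewrite !lebesgue_rV_boxE.
have -> : ((c ^+ d)^-1)%:E = (\prod_(i < d) (c^-1)%:E)%E :> \bar R.
  rewrite prodEFin; congr (_%:E).
  by rewrite big_const_ord iter_mulr_1 exprVn.
rewrite -big_split /=; apply: eq_bigr => i _.
rewrite !lebesgue_measure_itv/= !lte_fin ltr_pM2r ?invr_gt0// ltrD2r.
case: ifPn => _; last by rewrite mule0.
by rewrite -!EFinB -EFinM; congr (_%:E); field; rewrite gt_eqF.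
Qed.

Lemma ge0_integral_affine (c : R) v D (f : 'rV[R]_d -> \bar R) : 0 < c ->
  measurable D -> measurable_fun D f -> (forall x, D x -> 0 <= f x)%E ->
  (\int[mu]_(x in affine c v @^-1` D) f (affine c v x) =
   ((c ^+ d)^-1)%:E * \int[mu]_(x in D) f x)%E.
Proof.
move=> c0 mD mf f0.
have k0 : 0 <= (c ^+ d)^-1 by rewrite invr_ge0 exprn_ge0// ltW.
rewrite -(@ge0_integral_pushforward _ _ _ _ R _ (measurable_affine c v) mu D f)//; last first.
  by move=> x; rewrite inE; exact: f0.
rewrite (@eq_measure_integral _ _ _ D (mscale (NngNum k0) mu) (affine_image_measure c v)).
  by rewrite ge0_integral_mscale.
by move=> A mA _; exact: lebesgue_affine.
Qed.

(** The conventions for infinite values, +oo - oo included, are compatible with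
multiplication by k > 0. *)
Lemma gt0_muleBr (k : R) (a b : \bar R) : 0 < k ->
  (k%:E * (a - b) = k%:E * a - k%:E * b)%E.
Proof.
move=> k0; move: a b => [a||] [b||] //=.
  by rewrite -!EFinM -!EFinB mulrBr.
all: by rewrite !(gt0_muley,gt0_muleNy,addeNy,addNye,addye,addey) ?lte_fin.
Qed.

(** The positive and the negative part of f are transformed separately. *)
Lemma integral_affine (c : R) v D (f : 'rV[R]_d -> \bar R) : 0 < c ->
  measurable D -> measurable_fun D f ->
  (\int[mu]_(x in affine c v @^-1` D) f (affine c v x) =
   ((c ^+ d)^-1)%:E * \int[mu]_(x in D) f x)%E.
Proof.
move=> c0 mD mf; rewrite integralE [in RHS]integralE.
rewrite gt0_muleBr ?invr_gt0 ?exprn_gt0//.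
congr (_ - _)%E.
  rewrite -(@ge0_integral_affine c v D (funepos f)) => //; last exact: measurable_funepos.
  by rewrite (funepos_comp f (affine c v)).
rewrite -(@ge0_integral_affine c v D (funeneg f)) => //; last exact: measurable_funeneg.
by rewrite (funeneg_comp f (affine c v)).
Qed.

End affine.

Section euclidean_norm.
Context {R : realType} {d : nat}.
Implicit Types (A D E : set 'rV[R]_d) (x y v c : 'rV[R]_d) (r : R).
Let mu := @lebesgue_rV R d.

Lemma dot_ge0 x : 0 <= dot x x.
Proof. by apply: sumr_ge0 => i _; rewrite -expr2 sqr_ge0. Qed.

Lemma enorm_ge0 x : 0 <= enorm x. Proof. exact: sqrtr_ge0. Qed.

Lemma enorm_gt0 x : x != 0 -> 0 < enorm x.
Proof.
move=> x0; rewrite /enorm sqrtr_gt0 lt_neqAle dot_ge0 andbT.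
apply: contra x0; rewrite eq_sym => /eqP.
move=> /psumr_eq0P H; apply/eqP/rowP => i; rewrite mxE.
have /H/(_ i isT)/eqP : forall j, true -> 0 <= x ord0 j * x ord0 j.
  by move=> j _; rewrite -expr2 sqr_ge0.
by rewrite mulf_eq0 orbb => /eqP.
Qed.

Lemma enorm0 : enorm (0 : 'rV[R]_d) = 0.
Proof.
by rewrite /enorm /dot big1 ?sqrtr0// => i _; rewrite mxE mul0r.
Qed.

Lemma enormZ (a : R) x : enorm (a *: x) = `|a| * enorm x.
Proof.
rewrite /enorm /dot -sqrtr_sqr -sqrtrM ?sqr_ge0// mulr_sumr; congr Num.sqrt.
by apply: eq_bigr => i _; rewrite !mxE; ring.
Qed.

Lemma enormN x : enorm (- x) = enorm x.
Proof. by rewrite -scaleN1r enormZ normrN1 mul1r. Qed.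

Lemma norm_le_enorm x : `|x| <= enorm x.
Proof.
have H i : `|x ord0 i| <= enorm x.
  rewrite /enorm -sqrtr_sqr ler_sqrt ?dot_ge0// /dot (bigD1 i)//= -expr2 lerDl.
  by apply: sumr_ge0 => j _; rewrite -expr2 sqr_ge0.
rewrite [leLHS]/Num.norm /= mx_normrE; apply/bigmax_leP => /=.
by split => [|[i j] _ /=]; [exact: enorm_ge0|rewrite (ord1 i)].
Qed.

Lemma enorm_le_norm x : enorm x <= d%:R * `|x|.
Proof.
rewrite -[leRHS]ger0_norm ?mulr_ge0// -sqrtr_sqr ler_sqrt ?sqr_ge0// exprMn.
apply: (@le_trans _ _ (d%:R * `|x| ^+ 2)).
  rewrite /dot mulr_natl -[X in _ *+ X]card_ord -sumr_const.
  apply: ler_sum => i _; rewrite -expr2 -real_normK ?num_real//.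
  by rewrite lerXn2r ?nnegrE// coord_le_norm.
rewrite ler_wpM2r ?sqr_ge0// expr2.
by case: (d) => [|n]; [rewrite mulr0|rewrite -natrM ler_nat leq_pmulr].
Qed.

Lemma measurable_enorm : measurable_fun setT (@enorm R d).
Proof.
apply: measurableT_comp; first exact: continuous_measurable_fun (@sqrt_continuous R).
by apply: measurable_sum => i; apply: measurable_funM; exact: measurable_coor.
Qed.

Lemma eball_affine c r : 0 < r -> eball c r = affine r^-1 (- (r^-1 *: c)) @^-1` (eball 0 1).
Proof.
move=> r0; apply/seteqP; split => x /=; rewrite /eball /affine /= subr0 -scalerBr enormZ;
  by rewrite gtr0_norm ?invr_gt0// mulrC ltr_pdivrMr// mul1r.
Qed.

Lemma measurable_eball c r : measurable (eball c r).
Proof.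
have [r0|r0] := ltP 0 r.
  rewrite eball_affine//; apply: measurable_affine_preimage.
  rewrite (_ : eball 0 1 = @enorm R d @^-1` `]-oo, 1[).
    rewrite -[X in measurable X]setTI; apply: measurable_enorm => //.
  by apply/seteqP; split => x; rewrite /eball /= in_itv /= subr0.
rewrite (_ : eball c r = set0)//; apply/seteqP; split => // x /=.
by rewrite /eball /= ltNge (le_trans r0 (enorm_ge0 _)).
Qed.

Lemma lebesgue_eball c r : 0 < r -> mu (eball c r) = ((r ^+ d)%:E * mu (eball 0 1))%E.
Proof.
move=> r0; rewrite eball_affine// lebesgue_affine ?invr_gt0//; last exact: measurable_eball.
by rewrite exprVn invrK.
Qed.

Lemma lebesgue_bounded A r : measurable A -> (forall x, A x -> `|x| <= r) -> (mu A < +oo)%E.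
Proof.
move=> mA Ar; pose B := box (fun=> - (r + 1)) (fun=> (r + 1)) : set 'rV[R]_d.
apply: (@le_lt_trans _ _ (mu B)).
  apply: le_measure; rewrite ?inE//; first exact: measurable_box.
  move=> x /Ar xr i; have := le_trans (coord_le_norm x i) xr.
  by rewrite /= in_itv/= ler_norml => /andP[? ?]; apply/andP; split; lra.
rewrite -ge0_fin_numE// /B /mu lebesgue_rV_boxE.
elim/big_ind : _ => //; first exact: fin_numM.
by move=> i _; rewrite lebesgue_measure_itv/=; case: ifP => // _; rewrite -EFinB.
Qed.

Lemma lebesgue_unit_ball_fin : mu (eball 0 1) \is a fin_num.
Proof.
rewrite ge0_fin_numE//; apply: (@lebesgue_bounded _ 1); first exact: measurable_eball.
by move=> x; rewrite /eball /= subr0 => /ltW; exact: le_trans (norm_le_enorm _).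
Qed.

Lemma sigma_finite_lebesgue_rV : sigma_finite setT mu.
Proof.
exists (fun k => box (fun=> - k%:R) (fun=> k%:R)); first by rewrite bigcup_box.
move=> k; split; first exact: measurable_box.
apply: (@lebesgue_bounded _ k%:R); first exact: measurable_box.
move=> x xk; rewrite [leLHS]/Num.norm /= mx_normrE; apply/bigmax_leP => /=.
split => // -[i j] _ /=; rewrite (ord1 i); have := xk j.
by rewrite /= in_itv/= ler_norml => /andP[/ltW -> ->].
Qed.

End euclidean_norm.

(** * The mutual Riesz energy of two sets *)

Section mutual_energy.
Context {R : realType} {d : nat}.
Implicit Types (A B D E : set 'rV[R]_d) (x y v c : 'rV[R]_d) (r s q : R).
Let mu := @lebesgue_rV R d.

(** A copy of Lebesgue measure that carries the sigma-finite structure required by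
the Tonelli theorem. *)
Definition lebesgue_sf : set 'rV[R]_d -> \bar R := mu.
HB.instance Definition _ := isMeasure.Build _ _ _ lebesgue_sf
  (measure0 mu) (measure_ge0 mu) (@measure_semi_sigma_additive _ _ _ mu).
HB.instance Definition _ := Measure_isSigmaFinite.Build _ _ _ lebesgue_sf
  (@sigma_finite_lebesgue_rV R d).

Definition riesz_kernel s x y : \bar R := ((enorm (x - y) `^ s)^-1)%:E.

Lemma riesz_kernel_ge0 s x y : (0 <= riesz_kernel s x y)%E.
Proof. by rewrite lee_fin invr_ge0 powR_ge0. Qed.

Lemma riesz_kernelC s x y : riesz_kernel s x y = riesz_kernel s y x.
Proof. by rewrite /riesz_kernel -opprB enormN. Qed.

Lemma measurable_riesz_kernel s :
  measurable_fun [set: 'rV[R]_d * 'rV[R]_d] (fun z => riesz_kernel s z.1 z.2).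
Proof.
apply/measurable_EFinP; rewrite /comp.
under eq_fun do rewrite -powRN.
have md : measurable_fun [set: 'rV[R]_d * 'rV[R]_d] (fun z => z.1 - z.2).
  apply: measurable_fun_coorP => i.
  under eq_fun do rewrite !mxE.
  by apply: measurable_funB; apply: (measurableT_comp (measurable_coor i)).
have me := measurableT_comp (@measurable_enorm R d) md.
exact: (measurableT_comp (measurable_powR (- s)) me).
Qed.

Lemma measurable_riesz_kernel2 s x : measurable_fun [set: 'rV[R]_d] (riesz_kernel s x).
Proof. exact: (measurableT_comp (measurable_riesz_kernel s) (measurable_pair1 x)). Qed.

Lemma measurable_comp_affine (k : R) v (f : 'rV[R]_d -> \bar R) : measurable_fun setT f ->
  measurable_fun setT (fun x => f (affine k v x)).
Proof. by move=> mf; exact: (measurableT_comp mf (measurable_affine k v)). Qed.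

Definition potential s B x : \bar R := (\int[mu]_(y in B) riesz_kernel s x y)%E.

(** The Riesz energy is the diagonal of this symmetric and biadditive function of
two sets, which gives access to the interaction of the parts of a set. *)
Definition mutual s A B : \bar R := (\int[mu]_(x in A) potential s B x)%E.

Lemma rieszE s A : riesz s A = mutual s A A. Proof. by []. Qed.

Lemma potential_ge0 s B x : (0 <= potential s B x)%E.
Proof. by apply: integral_ge0 => y _; exact: riesz_kernel_ge0. Qed.

Lemma mutual_ge0 s A B : (0 <= mutual s A B)%E.
Proof. by apply: integral_ge0 => y _; exact: potential_ge0. Qed.

Let restricted s A B (z : 'rV[R]_d * 'rV[R]_d) : \bar R :=
  ((fun z => riesz_kernel s z.1 z.2) \_ (A `*` B)) z.

Let measurable_restricted s A B : measurable A -> measurable B ->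
  measurable_fun setT (restricted s A B).
Proof.
move=> mA mB; apply/(measurable_restrictT _ (measurableX mA mB)).
exact: measurable_funTS (measurable_riesz_kernel s).
Qed.

Let restricted_ge0 s A B z : (0 <= restricted s A B z)%E.
Proof. by rewrite /restricted /patch; case: ifP => // _; exact: riesz_kernel_ge0. Qed.

(** The potential of B is a section integral of the kernel cut off outside
setT `*` B. *)
Lemma measurable_potential s B : measurable B -> measurable_fun setT (potential s B).
Proof.
move=> mB; have := @measurable_fun_fubini_tonelli_F _ _ _ _ R lebesgue_sf
  _ (measurable_restricted s measurableT mB) (restricted_ge0 s setT B).
apply: eq_measurable_fun => x _.
rewrite /potential /fubini_F [RHS]integral_mkcond; apply: eq_integral => y _.
by rewrite /restricted /patch in_setX in_setT.
Qed.

Lemma mutual_restricted s A B :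
  mutual s A B = (\int[mu]_x \int[mu]_y restricted s A B (x, y))%E.
Proof.
rewrite /mutual integral_mkcond; apply: eq_integral => x _.
rewrite /patch /potential; case: ifPn => xA.
  rewrite integral_mkcond; apply: eq_integral => y _.
  by rewrite /restricted /patch in_setX xA.
by rewrite integral0_eq// => y _; rewrite /restricted /patch in_setX (negbTE xA).
Qed.

(** Tonelli, the kernel being symmetric. *)
Lemma mutualC s A B : measurable A -> measurable B -> mutual s A B = mutual s B A.
Proof.
move=> mA mB; rewrite !mutual_restricted.
have := @fubini_tonelli _ _ _ _ R lebesgue_sf lebesgue_sf
  _ (measurable_restricted s mA mB) (restricted_ge0 s A B).
move=> ->; apply: eq_integral => y _; apply: eq_integral => x _.
by rewrite /restricted /patch !in_setX andbC /= riesz_kernelC.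
Qed.

Lemma mutualDl s A A' B : measurable A -> measurable A' -> measurable B ->
  [disjoint A & A'] -> mutual s (A `|` A') B = (mutual s A B + mutual s A' B)%E.
Proof.
move=> mA mA' mB AA'; apply: ge0_integral_setU => //.
  by apply: measurable_funTS; exact: measurable_potential.
by move=> x _; exact: potential_ge0.
Qed.

Lemma mutualDr s A B B' : measurable A -> measurable B -> measurable B' ->
  [disjoint B & B'] -> mutual s A (B `|` B') = (mutual s A B + mutual s A B')%E.
Proof.
move=> mA mB mB' BB'; rewrite mutualC//; last exact: measurableU.
by rewrite (mutualDl s mB mB' mA BB') (mutualC s mB mA) (mutualC s mB' mA).
Qed.

Lemma le_mutual s A A' B B' : measurable A -> measurable A' -> measurable B -> measurable B' ->
  A `<=` A' -> B `<=` B' -> (mutual s A B <= mutual s A' B')%E.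
Proof.
move=> mA mA' mB mB' AA' BB'.
apply: (@le_trans _ _ (mutual s A' B)).
  apply: ge0_subset_integral => //; first by apply: measurable_funTS; exact: measurable_potential.
  by move=> x _; exact: potential_ge0.
apply: ge0_le_integral => //.
- by move=> x _; exact: potential_ge0.
- by apply: measurable_funTS; exact: measurable_potential.
- by apply: measurable_funTS; exact: measurable_potential.
- move=> x _; apply: ge0_subset_integral => //.
    by apply: measurable_funTS; exact: measurable_riesz_kernel2.
  by move=> y _; exact: riesz_kernel_ge0.
Qed.

Lemma mutual_le_cst s A B (k : \bar R) : measurable A -> measurable B -> (0 <= k)%E ->
  (forall x, A x -> (potential s B x <= k)%E) -> (mutual s A B <= k * mu A)%E.
Proof.
move=> mA mB k0 H; rewrite -integral_cst//; apply: ge0_le_integral => //.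
- by move=> x _; exact: potential_ge0.
- by apply: measurable_funTS; exact: measurable_potential.
Qed.

(** Each of the two integrations contributes k ^- d, and the kernel is homogeneous
of degree -s. *)
Lemma riesz_scale s (k : R) v A : 0 < k -> measurable A ->
  riesz s (affine k v @^-1` A) = ((k `^ s / k ^+ d / k ^+ d)%:E * riesz s A)%E.
Proof.
move=> k0 mA; rewrite !rieszE.
have kinv0 : 0 <= (k ^+ d)^-1 by rewrite invr_ge0 exprn_ge0// ltW.
have P x : (potential s (affine k v @^-1` A) x =
    (k `^ s / k ^+ d)%:E * potential s A (affine k v x))%E.
  rewrite /potential.
  transitivity (\int[mu]_(y in affine k v @^-1` A)
      ((k `^ s)%:E * riesz_kernel s (affine k v x) (affine k v y)))%E.
    apply: eq_integral => y _; rewrite /riesz_kernel -EFinM; congr (_%:E).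
    rewrite /affine opprD addrACA subrr addr0 -scalerBr enormZ gtr0_norm//.
    by rewrite powRM ?enorm_ge0 ?ltW// invfM mulrA mulfV ?mul1r// gt_eqF// powR_gt0.
  have mk := measurable_comp_affine k v (measurable_riesz_kernel2 s (affine k v x)).
  have -> := @ge0_integralZl_EFin _ _ _ mu _ (measurable_affine_preimage k v mA)
    (fun y => riesz_kernel s (affine k v x) (affine k v y)) (fun y _ => riesz_kernel_ge0 _ _ _)
    (measurable_funTS mk) _ (powR_ge0 k s).
  have -> := @ge0_integral_affine _ _ k v A (riesz_kernel s (affine k v x)) k0 mA
    (measurable_funTS (measurable_riesz_kernel2 s _)) (fun y _ => riesz_kernel_ge0 _ _ _).
  by rewrite muleA.
have mp := measurable_comp_affine k v (measurable_potential s mA).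
rewrite /mutual; under eq_integral do rewrite P.
have -> := @ge0_integralZl_EFin _ _ _ mu _ (measurable_affine_preimage k v mA)
    (fun x => potential s A (affine k v x)) (fun y _ => potential_ge0 _ _ _)
    (measurable_funTS mp) (k `^ s / k ^+ d) (mulr_ge0 (powR_ge0 k s) kinv0).
have -> := @ge0_integral_affine _ _ k v A (potential s A) k0 mA
    (measurable_funTS (measurable_potential s mA)) (fun y _ => potential_ge0 _ _ _).
by rewrite muleA -EFinM.
Qed.

Lemma mutual_le_far s A B (L : R) : 0 < L -> 0 <= s -> measurable A -> measurable B ->
  (forall x y, A x -> B y -> L <= enorm (x - y)) ->
  (mutual s A B <= ((L `^ s)^-1)%:E * mu B * mu A)%E.
Proof.
move=> L0 s0 mA mB H; apply: mutual_le_cst => //.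
  by rewrite mule_ge0// lee_fin invr_ge0 powR_ge0.
move=> x Ax; rewrite -integral_cst//; apply: ge0_le_integral => //.
- by move=> y _; exact: riesz_kernel_ge0.
- by apply: measurable_funTS; exact: measurable_riesz_kernel2.
- move=> y By; rewrite lee_fin lef_pV2 ?posrE ?powR_gt0//; last first.
    by apply: lt_le_trans L0 _; exact: H.
  by apply: ge0_ler_powR; rewrite ?nnegrE ?enorm_ge0 ?(ltW L0)//; exact: H.
Qed.

(** The interactions between different D i are nonnegative. *)
Lemma riesz_bigsetU s (N : nat) (D : 'I_N -> set 'rV[R]_d) E :
  measurable E -> (forall i, measurable (D i)) -> trivIset setT D ->
  (forall i, D i `<=` E) -> (\sum_i riesz s (D i) <= riesz s E)%E.
Proof.
move=> mE mD tD DE.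
pose U := \big[setU/set0]_(i < N) D i.
have UE : U `<=` E.
  by rewrite /U; elim/big_ind : _ => // A B AE BE x [/AE|/BE].
have mU : measurable U by exact: bigsetU_measurable.
have DU i : D i `<=` U by rewrite /U (bigD1 i)//= => x Dx; left.
apply: (@le_trans _ _ (mutual s U U)); last by rewrite rieszE; exact: le_mutual.
rewrite /mutual ge0_integral_bigsetU//.
- by apply: lee_sum => i _; rewrite rieszE; exact: le_mutual.
- exact: index_enum_uniq.
- by apply: sub_trivIset tD.
- by apply: measurable_funTS; exact: measurable_potential.
- by move=> y _; exact: potential_ge0.
Qed.

End mutual_energy.

(** * Integrability of the Riesz kernel and its consequences *)

Section local_integrability.
Context {R : realType} {d : nat}.
Implicit Types (A B D E : set 'rV[R]_d) (x y v c : 'rV[R]_d) (r s q : R).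
Let mu := @lebesgue_rV R d.
Let V : R := fine (mu (eball 0 1)).

Lemma lebesgue_unit_ballE : mu (eball 0 1) = V%:E.
Proof. by rewrite fineK// lebesgue_unit_ball_fin. Qed.

Lemma enorm_distC x y : enorm (x - y) = enorm (y - x).
Proof. by rewrite -opprB enormN. Qed.

Lemma riesz_kernel0 s y : riesz_kernel s 0 y = ((enorm y `^ s)^-1)%:E.
Proof. by rewrite /riesz_kernel enorm_distC subr0. Qed.

Let annulus (n : nat) : set 'rV[R]_d := eball 0 ((1 / 2) ^+ n) `\` eball 0 ((1 / 2) ^+ n.+1).

Let measurable_annulus n : measurable (annulus n).
Proof. by apply: measurableD; exact: measurable_eball. Qed.

Let annulusP n x : annulus n x <-> (1 / 2) ^+ n.+1 <= enorm x < (1 / 2) ^+ n.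
Proof.
rewrite /annulus /eball /= subr0; split => [[-> /negP]|/andP[h ->]].
  by rewrite -leNgt => ->.
by split => //; apply/negP; rewrite -leNgt.
Qed.

Let trivIset_annulus : trivIset setT annulus.
Proof.
apply/trivIsetP => i j _ _ ij; apply/seteqP; split => // x [/annulusP/andP[i1 i2] /annulusP/andP[j1 j2]].
wlog ij' : i j ij i1 i2 j1 j2 / (i < j)%N.
  move=> H; have [|ji] := ltnP i j; first exact: H.
  by apply: (H j i) => //; [rewrite eq_sym|rewrite ltn_neqAle eq_sym ij].
have := lt_le_trans j2 (@ler_wiXn2l _ (1 / 2 : R) _ _ _ _ ij'); rewrite ltNge i1 => H.
by have : ~~ true by apply: H; lra.
Qed.

Let bigcup_annulus : \bigcup_n annulus n = eball 0 1 `\` [set 0].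
Proof.
apply/seteqP; split => x.
  move=> [n _ /annulusP /andP[h1 h2]]; split.
    rewrite /eball /= subr0; apply: lt_le_trans h2 _.
    by rewrite exprn_ile1//; lra.
  by move=> x0; move: h1; rewrite x0 enorm0 leNgt exprn_gt0.
move=> [+ /= /eqP/enorm_gt0 x0]; rewrite /eball /= subr0 => x1.
have P : exists n, (1 / 2) ^+ n.+1 <= enorm x.
  exists (Num.truncn (enorm x)^-1).
  rewrite -[X in _ <= X]invrK div1r exprVn lef_pV2 ?posrE ?invr_gt0 ?exprn_gt0//.
  apply: (@le_trans _ _ (Num.truncn (enorm x)^-1).+1%:R).
    by apply: ltW; exact: truncnS_gt.
  by rewrite -natrX ler_nat ltnW// ltn_expl.
exists (ex_minn P) => //; apply/annulusP.
case: ex_minnP => n -> min /=; case: n min => [|n] min; first by rewrite expr0.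
by rewrite ltNge; apply/negP => /min; rewrite ltnn.
Qed.

(** On the annulus 2^-(n+1) <= |x| < 2^-n the integrand is at most 2^((n+1) s),
and the measure of the annulus is at most a constant times 2^(-n d). As s < d,
these bounds form a convergent geometric series. *)
Lemma local_integrability s : 0 < s -> s < d%:R ->
  (\int[mu]_(x in eball 0 1) ((enorm x `^ s)^-1)%:E < +oo)%E.
Proof.
move=> s0 sd.
pose k x : \bar R := ((enorm x `^ s)^-1)%:E.
have k0 x : (0 <= k x)%E by rewrite lee_fin invr_ge0 powR_ge0.
have mk : measurable_fun setT k.
  have := measurable_riesz_kernel2 s (0 : 'rV[R]_d).
  by apply: eq_measurable_fun => x _; rewrite riesz_kernel0.
pose t : R := (1 / 2) `^ s.
have t0 : 0 < t by apply: powR_gt0; lra.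
pose z : R := (1 / 2) ^+ d / t.
have z0 : 0 < z by rewrite divr_gt0// exprn_gt0//; lra.
have z1 : z < 1.
  have h0 : (1 / 2 == 0 :> R) = false by rewrite gt_eqF//; lra.
  rewrite ltr_pdivrMr// [X in _ < X]mul1r -powR_mulrn; last lra.
  by rewrite /t /powR h0 ltr_expR ltr_nM2r// ln_lt0//; lra.
have pownt n : ((1 / 2) ^+ n) `^ s = t ^+ n.
  have h20 : 0 <= 1 / 2 :> R by lra.
  by rewrite -(powR_mulrn n h20) powRAC (powR_mulrn n (ltW t0)).
(* The origin belongs to no annulus, but there k takes the value 0^-1 = 0. *)
have -> : (\int[mu]_(x in eball 0 1) k x = \int[mu]_(x in \bigcup_n annulus n) k x)%E.
  rewrite bigcup_annulus integral_mkcond [RHS]integral_mkcond.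
  apply: eq_integral => x _; rewrite /patch in_setD in_set1.
  have [->|_] := eqVneq x 0; last by rewrite andbT.
  by rewrite andbF /k enorm0 powR0 ?gt_eqF// invr0; case: ifP.
rewrite ge0_integral_bigcup//; last by apply: measurable_funTS.
pose a := t^-1 * V.
have V0 : 0 <= V by rewrite fine_ge0.
have H n : (\int[mu]_(x in annulus n) k x <= (a * z ^+ n)%:E)%E.
  apply: (@le_trans _ _ (((t ^+ n.+1)^-1)%:E * mu (annulus n))%E).
    rewrite -integral_cst//; apply: ge0_le_integral => //; first exact: measurable_funTS.
    move=> x /annulusP/andP[h _]; rewrite lee_fin lef_pV2 ?posrE ?exprn_gt0//; last first.
      by apply: powR_gt0; apply: lt_le_trans h; rewrite exprn_gt0//; lra.
    rewrite -pownt; apply: ge0_ler_powR; rewrite ?nnegrE ?enorm_ge0 ?(ltW s0)//.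
  apply: (@le_trans _ _ (((t ^+ n.+1)^-1)%:E * mu (eball 0 ((1 / 2) ^+ n)))%E).
    apply: lee_wpmul2l; first by rewrite lee_fin invr_ge0 exprn_ge0// ltW.
    by apply: le_measure; rewrite ?inE//; [exact: measurable_eball|exact: subDsetl].
  rewrite lebesgue_eball; last by rewrite exprn_gt0//; lra.
  have -> : z ^+ n = ((1 / 2) ^+ n) ^+ d * (t ^+ n)^-1 by rewrite /z expr_div_n exprAC.
  rewrite lebesgue_unit_ballE -!EFinM lee_fin /a (exprS t) invfM.
  rewrite le_eqVlt; apply/orP; left; apply/eqP.
  have AC (b1 b2 b3 b4 : R) : b1 * b2 * (b3 * b4) = b1 * b4 * (b3 * b2) by ring.
  exact: AC.
have a0 : 0 <= a by rewrite mulr_ge0// invr_ge0 ltW.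
apply: (@le_lt_trans _ _ (a / (1 - z))%:E); last by rewrite ltry.
apply: lime_le; first by apply: is_cvg_nneseries => n _ _; apply: integral_ge0.
apply: nearW => n; apply: (@le_trans _ _ (\sum_(0 <= i < n) (a * z ^+ i)%:E)%E).
  by apply: lee_sum => i _; exact: H.
rewrite sumEFin lee_fin.
have := congr1 (fun f => f n) (@geometric_seriesE R a z (negbT (lt_eqF z1))).
rewrite /series /= => ->; rewrite ler_pM2r ?invr_gt0 ?subr_gt0//.
rewrite -[leRHS]mulr1; apply: ler_wpM2l => //.
by rewrite lerBlDr lerDl exprn_ge0// ltW.
Qed.

(** The kernel is at most 1 at distance 1 or more; the remaining part is bounded by
the integral over a unit ball centred at x. *)
Lemma potential_bound s : 0 < s -> s < d%:R ->
  exists2 C : R, 0 <= C & forall E x, measurable E -> (potential s E x <= C%:E + mu E)%E.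
Proof.
move=> s0 sd.
pose K := (\int[mu]_(x in eball 0 1) ((enorm x `^ s)^-1)%:E)%E.
have K0 : (0 <= K)%E by apply: integral_ge0 => x _; rewrite lee_fin invr_ge0 powR_ge0.
exists (fine K); first exact: fine_ge0.
move=> E x mE; rewrite fineK; last by rewrite ge0_fin_numE// local_integrability.
have mk : measurable_fun setT (fun x : 'rV[R]_d => ((enorm x `^ s)^-1)%:E).
  have := measurable_riesz_kernel2 s (0 : 'rV[R]_d).
  by apply: eq_measurable_fun => y _; rewrite riesz_kernel0.
have mB := measurable_eball x 1.
rewrite /potential -(setUIDK E (eball x 1)) ge0_integral_setU; last 5 first.
- exact: measurableI.
- exact: measurableD.
- by apply: measurable_funTS; exact: measurable_riesz_kernel2.
- by move=> y _; exact: riesz_kernel_ge0.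
- by rewrite disj_set2E; apply/eqP; rewrite -subset0 => y [[_ ?] [_]].
apply: leeD.
  apply: (@le_trans _ _ (potential s (eball x 1) x)).
    apply: ge0_subset_integral => //.
    - exact: measurableI.
    - by apply: measurable_funTS; exact: measurable_riesz_kernel2.
    - by move=> y _; exact: riesz_kernel_ge0.
  have := @ge0_integral_affine R d 1 (- x) (eball 0 1) (fun x => ((enorm x `^ s)^-1)%:E)
     ltr01 (measurable_eball _ _) (measurable_funTS mk) _.
  rewrite expr1n invr1 mul1e -/K => <-; last by move=> y _; rewrite lee_fin invr_ge0 powR_ge0.
  have -> : affine 1 (- x) @^-1` eball 0 1 = eball x 1.
    by rewrite (eball_affine x ltr01) invr1 scale1r.
  apply: ge0_le_integral.
  - exact: measurable_eball.
  - by move=> y _; exact: riesz_kernel_ge0.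
  - by apply: measurable_funTS; exact: measurable_riesz_kernel2.
  - by apply: measurable_funTS; exact: (measurable_comp_affine 1 (- x) mk).
  by move=> y _; rewrite /riesz_kernel enorm_distC /affine scale1r.
rewrite setUIDK.
apply: (@le_trans _ _ (1%:E * mu (E `\` eball x 1))%E).
  rewrite -integral_cst; last exact: measurableD.
  apply: ge0_le_integral => //.
  - exact: measurableD.
  - by move=> y _; exact: riesz_kernel_ge0.
  - by apply: measurable_funTS; exact: measurable_riesz_kernel2.
  move=> y [_]; rewrite /eball /= => /negP; rewrite -leNgt => yx.
  rewrite lee_fin invf_le1; last by apply: powR_gt0; rewrite enorm_distC; lra.
  rewrite enorm_distC -[leLHS](congr1 (@^~ s) (@powR1 R)).
  by apply: ge0_ler_powR; rewrite ?nnegrE ?enorm_ge0 ?(ltW s0).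
rewrite mul1e; apply: le_measure; rewrite ?inE; [exact: measurableD|exact: mE|by move=> y []].
Qed.

Lemma attraction_bound q : 0 < q -> q < d%:R ->
  exists2 C : R, 0 <= C & forall E, measurable E -> (attraction q E <= C%:E + mu E)%E.
Proof.
move=> q0 qd; have [C C0 H] := potential_bound q0 qd; exists C => // E mE.
apply: le_trans (H E 0 mE); rewrite /potential.
by under [leRHS]eq_integral do rewrite riesz_kernel0.
Qed.

(** What is lost is the interaction of E `\` A with E and with A, each at most the
measure of E `\` A times the largest potential. *)
Lemma riesz_truncate s : 0 < s -> s < d%:R -> exists2 C : R, 0 <= C &
  forall A E, measurable A -> measurable E -> A `<=` E ->
    (riesz s E <= riesz s A + (C%:E + mu E) * mu (E `\` A) *+ 2)%E.
Proof.
move=> s0 sd; have [C C0 H] := potential_bound s0 sd; exists C => // A E mA mE AE.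
have mD : measurable (E `\` A) by exact: measurableD.
have disj : [disjoint A & E `\` A] by rewrite disj_set2E setDIK.
rewrite !rieszE -[X in (mutual s X X <= _)%E](setDUK AE).
rewrite mutualDl ?setDUK// -[X in (mutual s A X + _ <= _)%E](setDUK AE) mutualDr//.
rewrite [mutual s A (E `\` A)]mutualC// -addeA leeD2l// mule2n.
have B F : measurable F -> F `<=` E -> (mutual s (E `\` A) F <= (C%:E + mu E) * mu (E `\` A))%E.
  move=> mF FE; apply: mutual_le_cst => //; first by rewrite adde_ge0.
  move=> x _; apply: le_trans (H F x mF) _; apply: leeD => //.
  by apply: le_measure; rewrite ?inE.
by apply: leeD; exact: B.
Qed.

Lemma riesz_fin s E : 0 < s -> s < d%:R -> measurable E -> mu E \is a fin_num ->
  riesz s E \is a fin_num.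
Proof.
move=> s0 sd mE fE; have [C C0 H] := riesz_truncate s0 sd.
rewrite ge0_fin_numE; last exact: mutual_ge0.
apply: le_lt_trans (H set0 E measurable0 mE (@sub0set _ E)) _.
rewrite rieszE /mutual integral_set0 add0e setD0 -ge0_fin_numE; last first.
  by rewrite mule2n adde_ge0// mule_ge0// adde_ge0.
by rewrite mule2n fin_numD fin_numM// fin_numD fE.
Qed.

(** The kernel takes the value 0 instead of infinity on the diagonal; restricting
the inner integral to the points at distance at least 1/2 from x avoids the
diagonal and leaves a set of measure at least (1 - 2^-d) |B|. *)
Lemma riesz_unit_ball_gt0 s : (0 < d)%N -> 0 < s -> (0 < mu (eball 0 1))%E ->
  (0 < riesz s (eball 0 1 : set 'rV[R]_d))%E.
Proof.
move=> d0 s0 V0.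
have mB r := measurable_eball (0 : 'rV[R]_d) r.
pose k : R := ((d%:R * 2) `^ s)^-1.
have d0' : 0 < d%:R :> R by rewrite ltr0n.
have k0 : 0 < k by rewrite invr_gt0 powR_gt0// mulr_gt0.
have Vp : 0 < V by rewrite -lte_fin -lebesgue_unit_ballE.
pose h : R := 1 - (1 / 2) ^+ d.
have h0 : 0 < h by rewrite subr_gt0 exprn_ilt1 -?lt0n//; lra.
apply: (@lt_le_trans _ _ ((k * (h * V))%:E * mu (eball 0 1))%E).
  by rewrite lebesgue_unit_ballE lte_fin !mulr_gt0.
rewrite rieszE /mutual -integral_cst//.
apply: ge0_le_integral => //.
- by move=> x _; rewrite lee_fin !mulr_ge0 // ltW.
- by apply: measurable_funTS; exact: measurable_potential.
move=> x; rewrite /eball /= subr0 => x1.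
pose B := eball 0 1 `\` eball x (1 / 2).
have mBB : measurable B by apply: measurableD => //; exact: measurable_eball.
apply: (@le_trans _ _ (k%:E * mu B)%E).
  rewrite EFinM lee_pmul2l ?lte_fin//.
  have mux : mu (eball x (1 / 2)) = ((1 / 2) ^+ d * V)%:E.
    by rewrite lebesgue_eball ?lebesgue_unit_ballE -?EFinM//; lra.
  rewrite /B measureD//; last 2 first.
    exact: measurable_eball.
    by rewrite ltey_eq lebesgue_unit_ball_fin.
  apply: (@le_trans _ _ (mu (eball 0 1) - mu (eball x (1 / 2)))%E).
    by rewrite lebesgue_unit_ballE mux -EFinB lee_fin /h; lra.
  apply: leeB => //; apply: le_measure; rewrite ?inE; last by move=> y [].
    by apply: measurableI => //; exact: measurable_eball.
  exact: measurable_eball.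
rewrite -integral_cst// /potential.
apply: (@le_trans _ _ (\int[mu]_(y in B) riesz_kernel s x y)%E).
  apply: ge0_le_integral => //.
  - by move=> y _; rewrite lee_fin ltW.
  - by apply: measurable_funTS; exact: measurable_riesz_kernel2.
  move=> y [/= + /negP]; rewrite /eball /= subr0 -leNgt => y1 xy.
  have e0 : 0 < enorm (x - y) by rewrite (enorm_distC x y); lra.
  rewrite lee_fin lef_pV2 ?posrE ?powR_gt0 ?mulr_gt0//.
  apply: ge0_ler_powR; rewrite ?nnegrE ?enorm_ge0 ?(ltW s0) ?mulr_ge0//.
  apply: le_trans (enorm_le_norm _) _; rewrite ler_pM2l//.
  apply: le_trans (ler_normB _ _) _.
  have := le_lt_trans (norm_le_enorm x) x1; have := le_lt_trans (norm_le_enorm y) y1; lra.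
apply: ge0_subset_integral.
- exact: mBB.
- exact: mB.
- by apply: measurable_funTS; exact: measurable_riesz_kernel2.
- by move=> y _; exact: riesz_kernel_ge0.
- by move=> y [].
Qed.

End local_integrability.

(** * Test fields for the perimeter *)

Section test_fields.
Context {R : realType} {d : nat}.
Implicit Types (A B D E : set 'rV[R]_d) (x y v c : 'rV[R]_d) (r : R) (phi : 'rV[R]_d -> 'rV[R]_d).
Let mu := @lebesgue_rV R d.

Lemma compact_closure_bounded A : compact (closure A) <-> exists r, forall x, A x -> `|x| <= r.
Proof.
split => [/compact_bounded[M [_ H]]|[r Ar]].
  exists (M + 1) => x Ax; apply: H; first by rewrite ltrDl.
  exact: subset_closure.
apply: bounded_closed_compact; last exact: closed_closure.
exists r; split; first exact: num_real.
move=> M rM x Ax.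
have : closure A `<=` closed_ball_ (fun x => `|x|) (0 : 'rV[R]_d) r.
  move=> z Az.
  rewrite ((closure_id _).1 (@closed_closed_ball_ _ _ (0 : 'rV[R]_d) r)).
  by apply: closureS Az => y Ay; rewrite /closed_ball_ /= sub0r normrN; exact: Ar.
by move=> /(_ x Ax); rewrite /closed_ball_ /= sub0r normrN => /le_trans; apply; exact: ltW.
Qed.

Lemma continuous_sum (W : normedModType R) N (f : 'I_N -> 'rV[R]_d -> W) :
  (forall i, continuous (f i)) -> continuous (fun x => \sum_i f i x).
Proof.
move=> cf; rewrite (_ : (fun x => _) = \sum_i f i); last by apply/funext => x; rewrite fct_sumE.
elim/big_ind : _ => //; first exact: cst_continuous.
by move=> g h cg ch x; apply: continuousD; [exact: cg|exact: ch].
Qed.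

(** Boundedness is easier to propagate through operations on fields than
compactness of a closure. *)
Lemma C1c_fieldP phi : C1c_field phi <-> [/\ forall x, differentiable phi x,
  forall i, continuous (partial i phi) &
  exists r, forall x, phi x != 0 -> `|x| <= r].
Proof. by split=> -[? ? /compact_closure_bounded]; split. Qed.

(** A field vanishes in a neighbourhood of any point out of a closed ball that
contains its support. *)
Lemma partial_out phi i x r : (forall y, phi y != 0 -> `|y| <= r) -> r < `|x| ->
  partial i phi x = 0.
Proof.
move=> supp rx; rewrite /partial.
rewrite (@near_eq_derive _ _ _ phi (cst 0)) ?derive_cst//.
near=> y; apply/eqP; apply: contraT => /supp; rewrite leNgt => /negP; case.
near: y; apply: (@open_nbhs_nbhs _ x [set y | r < `|y|]); split => //.
by apply: (@open_comp _ _ (fun y : 'rV[R]_d => `|y|) [set t | r < t]); [move=> z _; exact: norm_continuous|exact: open_gt].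
Unshelve. all: by end_near. Qed.

Lemma divergence_out phi x r : (forall y, phi y != 0 -> `|y| <= r) -> r < `|x| ->
  divergence phi x = 0.
Proof.
by move=> supp rx; rewrite /divergence big1// => i _; rewrite (partial_out i supp rx) mxE.
Qed.

Lemma continuous_divergence phi : C1c_field phi -> continuous (divergence phi).
Proof.
move=> /C1c_fieldP[_ cphi _]; apply: (@continuous_sum R^o d (fun i x => partial i phi x ord0 i)) => i x.
apply: (@continuous_comp _ _ _ (partial i phi) (fun y : 'rV[R]_d => y ord0 i)).
  exact: cphi.
exact: coord_continuous.
Qed.

Lemma measurable_divergence phi : C1c_field phi -> measurable_fun setT (divergence phi).
Proof. by move=> /continuous_divergence; exact: continuous_measurable_rV. Qed.

Lemma divergence_bounded phi : C1c_field phi ->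
  exists2 C : R, 0 <= C & forall x, `|divergence phi x| <= C.
Proof.
move=> Hphi; have [_ _ [r supp]] := (C1c_fieldP phi).1 Hphi.
have cB : compact (closed_ball_ (fun x => `|x|) (0 : 'rV[R]_d) r).
  apply: bounded_closed_compact; last exact: closed_closed_ball_.
  exists r; split; first exact: num_real.
  by move=> M rM x; rewrite /closed_ball_ /= sub0r normrN => /le_trans; apply; exact: ltW.
have := @continuous_compact _ _ (divergence phi) _ _ cB.
move=> /(_ (continuous_subspaceT (continuous_divergence Hphi))) /compact_bounded[M [_ H]].
exists `|M + 1| => // x; have [xr|rx] := leP `|x| r.
  apply: le_trans (ler_norm _); apply: H; first by rewrite ltrDl.
  by exists x => //; rewrite /closed_ball_ /= sub0r normrN.
by rewrite (divergence_out supp rx) normr0.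
Qed.

Lemma is_diff_affine k v x : is_diff x (affine k v : 'rV[R]_d -> 'rV[R]_d) ( *:%R k).
Proof.
have := @is_diffD _ _ _ _ _ _ _ x (is_diff_scaler k x) (is_diff_cst v x).
by rewrite addr0.
Qed.

Lemma affine_continuous k v : continuous (affine k v : 'rV[R]_d -> 'rV[R]_d).
Proof. by move=> x; apply: differentiable_continuous; have [] := is_diff_affine k v x. Qed.

Lemma derive_affine phi k v w x : differentiable phi (affine k v x) ->
  differentiable (fun x => phi (affine k v x)) x /\
  'D_w (fun x => phi (affine k v x)) x = k *: 'D_w phi (affine k v x).
Proof.
move=> dphi.
have [dTx dTE] := is_diff_affine k v x.
have dc : differentiable (phi \o affine k v) x by exact: differentiable_comp.
split; first exact: dc.
transitivity ('d (phi \o affine k v) x w); first exact: (deriveE _ dc).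
rewrite (deriveE _ dphi) -linearZ.
have dTw : 'd (affine k v) x w = k *: w := congr1 (@^~ w) dTE.
have E := congr1 (fun f : 'rV[R]_d -> 'rV[R]_d => f w) (diff_comp dTx dphi).
exact: (etrans E (congr1 ('d phi (affine k v x)) dTw)).
Qed.

Lemma divergence_affine phi k v x : differentiable phi (affine k v x) ->
  divergence (fun x => phi (affine k v x)) x = k * divergence phi (affine k v x).
Proof.
move=> dphi; rewrite /divergence mulr_sumr; apply: eq_bigr => i _.
by rewrite /partial (derive_affine _ dphi).2 mxE.
Qed.

Lemma C1c_field_affine phi k v : 0 < k -> C1c_field phi ->
  C1c_field (fun x => phi (affine k v x)).
Proof.
move=> k0 /C1c_fieldP[dphi cphi [r supp]]; apply/C1c_fieldP; split.
- by move=> x; exact: (derive_affine 0 (dphi (affine k v x))).1.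
- move=> i; rewrite (_ : partial i _ = fun x => k *: partial i phi (affine k v x)).
    have H x : {for x, continuous (partial i phi \o affine k v)}.
      by apply: continuous_comp; [exact: affine_continuous|exact: cphi].
    by move=> x; exact: (continuousZl_tmp (H x)).
  by apply/funext => x; rewrite /partial (derive_affine _ (dphi _)).2.
- exists ((r + `|v|) / k) => x /supp; rewrite ler_pdivlMr// mulrC => h.
  rewrite -[X in X * _]gtr0_norm// -normrZ -[X in `|X|](addrK v).
  by apply: le_trans (ler_normB _ _) _; rewrite lerD2r.
Qed.

Lemma C1c_field_sum N (phi : 'I_N -> 'rV[R]_d -> 'rV[R]_d) : (forall i, C1c_field (phi i)) ->
  C1c_field (\sum_i phi i) /\ forall x, divergence (\sum_i phi i) x = \sum_i divergence (phi i) x.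
Proof.
move=> Hphi; have H i := (C1c_fieldP (phi i)).1 (Hphi i).
have dphi i x : differentiable (phi i) x by have [] := H i.
have P j x : partial j (\sum_i phi i) x = \sum_i partial j (phi i) x.
  by rewrite /partial derive_sum// => i; exact: diff_derivable.
split; last first.
  move=> x; rewrite /divergence exchange_big/=; apply: eq_bigr => j _.
  by rewrite P summxE.
apply/C1c_fieldP; split.
- by move=> x; exact: differentiable_sum.
- move=> j; rewrite (_ : partial j _ = fun x => \sum_i partial j (phi i) x); last first.
    by apply/funext => x; rewrite P.
  apply: continuous_sum => i.
  by have [_ + _] := H i; exact.
- have /choice[r Hr] : forall i, exists r, forall x, phi i x != 0 -> `|x| <= r.
    by move=> i; have [] := H i.
  exists (\sum_i `|r i|) => x; rewrite fct_sumE.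
  have [/existsP[i ix] _|] := boolP [exists i, phi i x != 0].
    apply: le_trans (Hr i x ix) _; apply: le_trans (ler_norm _) _.
    by rewrite (bigD1 i)//= lerDl sumr_ge0.
  rewrite negb_exists => /forallP h; rewrite big1 ?eqxx// => i _.
  by have := h i; rewrite negbK => /eqP.
Qed.

End test_fields.

(** * Perimeter and Riesz energy of separated pieces *)

Section perimeter_theory.
Context {R : realType} {d : nat}.
Implicit Types (A B D E : set 'rV[R]_d) (x y v c : 'rV[R]_d) (r k : R) (phi : 'rV[R]_d -> 'rV[R]_d).
Let mu := @lebesgue_rV R d.

Lemma divergence_le_perimeter E phi : C1c_field phi -> (forall x, enorm (phi x) <= 1) ->
  (\int[mu]_(x in E) (divergence phi x)%:E <= perimeter E)%E.
Proof. by move=> H1 H2; apply: ereal_sup_ubound; exists phi. Qed.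

Lemma perimeter_le E (p : \bar R) :
  (forall phi, C1c_field phi -> (forall x, enorm (phi x) <= 1) ->
    (\int[mu]_(x in E) (divergence phi x)%:E <= p)%E) -> (perimeter E <= p)%E.
Proof. by move=> H; apply: ge_ereal_sup => _ [phi [? ?] <-]; exact: H. Qed.

Lemma measurable_EFin_divergence phi D : C1c_field phi ->
  measurable_fun D (EFin \o divergence phi).
Proof.
by move=> H; apply/measurable_EFinP; apply: measurable_funTS; exact: measurable_divergence.
Qed.

Lemma perimeter_ge0 E : (0 <= perimeter E)%E.
Proof.
pose z := fun _ : 'rV[R]_d => (0 : 'rV[R]_d).
have P i x : partial i z x = 0 by rewrite /partial derive_cst.
have D x : divergence z x = 0 by rewrite /divergence big1// => i _; rewrite P mxE.
have zC : C1c_field z.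
  apply/C1c_fieldP; split.
  - by move=> x; exact: differentiable_cst.
  - move=> i; rewrite (_ : partial i z = cst 0); first exact: cst_continuous.
    by apply/funext => x; rewrite P.
  - by exists 0 => x; rewrite eqxx.
apply: le_trans (divergence_le_perimeter E zC _) => [|x].
  by rewrite integral0_eq// => x _; rewrite D.
by rewrite enorm0.
Qed.

Lemma perimeter_setU A B : measurable A -> measurable B -> [disjoint A & B] ->
  (perimeter (A `|` B) <= perimeter A + perimeter B)%E.
Proof.
move=> mA mB AB; apply: perimeter_le => phi Hphi phi1.
rewrite integral_setU//; last exact: measurable_EFin_divergence.
by apply: leeD; exact: divergence_le_perimeter.
Qed.

Lemma gt0_integralZl k D (f : 'rV[R]_d -> \bar R) : 0 < k -> measurable D ->
  measurable_fun D f ->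
  (\int[mu]_(x in D) (k%:E * f x) = k%:E * \int[mu]_(x in D) f x)%E.
Proof.
move=> k0 mD mf; have k0' := ltW k0.
rewrite integralE [in RHS]integralE gt0_muleBr// ge0_funeposM// ge0_funenegM//.
congr (_ - _)%E; apply: ge0_integralZl_EFin => //.
  exact: measurable_funepos.
exact: measurable_funeneg.
Qed.

(** If phi is a competitor for the preimage, then phi composed with the inverse map
is one for E, and its divergence is scaled by the inverse factor. *)
Lemma perimeter_affine_le k v E : 0 < k -> measurable E ->
  (perimeter (affine k v @^-1` E) <= (k / k ^+ d)%:E * perimeter E)%E.
Proof.
move=> k0 mE; apply: perimeter_le => phi Hphi phi1.
pose psi x := phi (affine k^-1 (- (k^-1 *: v)) x).
have Hpsi : C1c_field psi by apply: C1c_field_affine => //; rewrite invr_gt0.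
have psiK x : psi (affine k v x) = phi x.
  by rewrite /psi /affine scalerDr scalerA mulVf ?gt_eqF// scale1r addrK.
have psi1 x : enorm (psi x) <= 1 by exact: phi1.
clearbody psi.
have Ephi : (fun x => psi (affine k v x)) = phi by apply/funext => x; exact: psiK.
have [dpsi _ _] := (C1c_fieldP psi).1 Hpsi.
have Dphi x : divergence phi x = k * divergence psi (affine k v x).
  by have := divergence_affine (dpsi (affine k v x)); rewrite Ephi.
have mpsi : measurable_fun E (EFin \o divergence psi) by exact: measurable_EFin_divergence.
have -> : (\int[mu]_(x in affine k v @^-1` E) (divergence phi x)%:E =
    \int[mu]_(x in affine k v @^-1` E) (k%:E * (divergence psi (affine k v x))%:E))%E.
  by apply: eq_integral => x _; rewrite Dphi EFinM.
have -> := @integral_affine R d k v E (fun x => k%:E * (divergence psi x)%:E)%E k0 mE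
  (measurable_funeM _ mpsi).
have -> := gt0_integralZl k0 mE mpsi.
rewrite muleA -EFinM mulrC lee_pmul2l//; last by rewrite lte_fin divr_gt0// exprn_gt0.
exact: divergence_le_perimeter.
Qed.

(** The converse inequality is the same one for the inverse map. *)
Lemma perimeter_affine k v E : 0 < k -> measurable E ->
  perimeter (affine k v @^-1` E) = ((k / k ^+ d)%:E * perimeter E)%E.
Proof.
move=> k0 mE; apply/eqP; rewrite eq_le perimeter_affine_le//=.
have kd0 : 0 < k / k ^+ d by rewrite divr_gt0// exprn_gt0.
rewrite -lee_pdivlMl//.
have E' : affine k^-1 (- (k^-1 *: v)) @^-1` (affine k v @^-1` E) = E.
  apply/seteqP; split => x; rewrite /preimage /= /affine scalerDr scalerA mulfV ?gt_eqF//;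
    by rewrite scale1r scalerN scalerA mulfV ?gt_eqF// scale1r subrK.
rewrite -{1}E'; have k0' : 0 < k^-1 by rewrite invr_gt0.
apply: le_trans (perimeter_affine_le _ k0' (measurable_affine_preimage k v mE)) _.
by rewrite invfM invrK exprVn invrK.
Qed.

Lemma bounded_integrable (g : 'rV[R]_d -> R) (C : R) D :
  measurable_fun setT g -> (forall x, `|g x| <= C) ->
  measurable D -> (mu D < +oo)%E -> mu.-integrable D (EFin \o g).
Proof.
move=> mg gC mD fD; apply: measurable_bounded_integrable => //; first exact: measurable_funTS.
by exists C; split; [exact: num_real|move=> M CM x _; apply: le_trans (gC x) (ltW CM)].
Qed.

Lemma integral_symdiff (g : 'rV[R]_d -> R) (C : R) A B : 0 <= C ->
  measurable_fun setT g -> (forall x, `|g x| <= C) ->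
  measurable A -> measurable B -> (mu A < +oo)%E -> (mu B < +oo)%E ->
  (\int[mu]_(x in B) (g x)%:E <= \int[mu]_(x in A) (g x)%:E + C%:E * mu (symdiff A B))%E.
Proof.
move=> C0 mg gC mA mB fA fB.
have mAB := measurableI _ _ mA mB.
have mAD := measurableD mA mB.
have mBD := measurableD mB mA.
have mg' D : measurable_fun D (EFin \o g).
  by apply/measurable_EFinP; exact: measurable_funTS.
have up D : measurable D -> (mu D < +oo)%E ->
    (`|\int[mu]_(x in D) (g x)%:E| <= C%:E * mu D)%E.
  move=> mD fD; apply: le_trans (le_abse_integral _ _ _) _ => //.
  rewrite -integral_cst//; apply: ge0_le_integral => //.
    by apply: measurableT_comp.
  by move=> x _; rewrite lee_fin.
have fAD : (mu (A `\` B) < +oo)%E.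
  by apply: le_lt_trans fA; apply: le_measure; rewrite ?inE//; exact: subDsetl.
have fBD : (mu (B `\` A) < +oo)%E.
  by apply: le_lt_trans fB; apply: le_measure; rewrite ?inE//; exact: subDsetl.
have EA : (\int[mu]_(x in A) (g x)%:E = \int[mu]_(x in A `&` B) (g x)%:E + \int[mu]_(x in A `\` B) (g x)%:E)%E.
  rewrite -integral_setU//; first by rewrite setUIDK.
  by rewrite disj_set2E; apply/eqP; rewrite -subset0 => y [[_ ?] [_]].
have EB : (\int[mu]_(x in B) (g x)%:E = \int[mu]_(x in A `&` B) (g x)%:E + \int[mu]_(x in B `\` A) (g x)%:E)%E.
  have dj : [disjoint B `&` A & B `\` A].
    by rewrite disj_set2E; apply/eqP; rewrite -subset0 => y [[_ ?] [_]].
  by rewrite (setIC A) -[in LHS](setUIDK B A) integral_setU//; exact: measurableI.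
have ES : mu (symdiff A B) = (mu (A `\` B) + mu (B `\` A))%E.
  rewrite /symdiff measureU//.
  by rewrite -subset0 => y [[? ?] [? ?]].
rewrite EA EB ES muleDr ?ge0_adde_def ?inE// -addeA leeD2l//.
have h1 := up _ mAD fAD; have h2 := up _ mBD fBD.
rewrite addeA; apply: (@le_trans _ _ (C%:E * mu (B `\` A))%E).
  exact: le_trans (lee_abs _) h2.
apply: leeDr.
have /integrable_fin_num fin1 := bounded_integrable mg gC mAD fAD.
rewrite -(fineK (fin1 mAD)); rewrite -(fineK (fin1 mAD)) in h1.
case: (C%:E * mu (A `\` B))%E h1 => [c| |] //; last by move=> _; rewrite addey// lee0y.
by rewrite -EFinD !lee_fin ler_norml => /andP[+ _]; rewrite -lerBlDr sub0r.
Qed.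

Lemma perimeter_null A B : measurable A -> measurable B ->
  (mu A < +oo)%E -> (mu B < +oo)%E -> mu (symdiff A B) = 0%E ->
  perimeter A = perimeter B.
Proof.
wlog suff W : A B / measurable A -> measurable B ->
  (mu A < +oo)%E -> (mu B < +oo)%E -> mu (symdiff A B) = 0%E ->
  (perimeter A <= perimeter B)%E.
  move=> mA mB fA fB AB; apply/eqP; rewrite eq_le !W//.
  by move: AB; rewrite /symdiff setUC.
move=> mA mB fA fB AB; apply: perimeter_le => phi Hphi phi1.
have [C C0 HC] := divergence_bounded Hphi.
apply: le_trans (divergence_le_perimeter B Hphi phi1).
have := integral_symdiff C0 (measurable_divergence Hphi) HC mB mA fB fA.
by rewrite /symdiff setUC -/(symdiff A B) AB mule0 adde0.
Qed.

Lemma translate_affine A v : translate A v = affine 1 (- v) @^-1` A.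
Proof.
apply/seteqP; split => x /=.
  by move=> [y Ay <-]; rewrite /affine scale1r addrK.
by rewrite /affine scale1r => Ax; exists (x - v) => //; rewrite subrK.
Qed.

Lemma measurable_translate A v : measurable A -> measurable (translate A v).
Proof. by rewrite translate_affine; exact: measurable_affine_preimage. Qed.

Lemma lebesgue_translate A v : measurable A -> mu (translate A v) = mu A.
Proof. by move=> mA; rewrite translate_affine lebesgue_affine// expr1n invr1 mul1e. Qed.

Lemma riesz_translate s A v : measurable A -> riesz s (translate A v) = riesz s A.
Proof.
by move=> mA; rewrite translate_affine riesz_scale// powR1 expr1n !divr1 mul1e.
Qed.

Section separated.
Variables (N : nat) (E : 'I_N -> set 'rV[R]_d) (c : 'I_N -> 'rV[R]_d) (rho : R).
Hypothesis mE : forall i, measurable (E i).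
Hypothesis Erho : forall i x, E i x -> `|x| <= rho.
Hypothesis far : forall i j, i != j -> rho *+ 2 < `|c i - c j|.

Let U := \bigcup_i translate (E i) (c i).

Lemma separated_uniq i j x : `|x - c i| <= rho -> `|x - c j| <= rho -> i = j.
Proof.
move=> xi xj; apply/eqP; apply: contraT => /far; rewrite ltNge; case/negP.
rewrite (_ : c i - c j = (x - c j) - (x - c i)).
  by apply: le_trans (ler_normB _ _) _; rewrite mulr2n lerD.
by rewrite opprB [RHS]addrC addrA subrK.
Qed.

Lemma translate_near i x : translate (E i) (c i) x -> `|x - c i| <= rho.
Proof. by move=> [y Ey <-]; rewrite addrK; exact: Erho Ey. Qed.

Lemma trivIset_translate : trivIset setT (fun i => translate (E i) (c i)).
Proof.
apply/trivIsetP => i j _ _ ij; rewrite -subset0 => x [/translate_near xi /translate_near xj].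
by move: ij; rewrite (separated_uniq xi xj) eqxx.
Qed.

Lemma measurable_separated : measurable U.
Proof.
by apply: fin_bigcup_measurable => // i _; exact: measurable_translate.
Qed.

(** The translated fields psi i have disjoint supports, hence their sum is a
competitor for the perimeter of Omega. For each i, the divergence of psi i
integrates over U as over the i-th piece only, and passing from U to Omega
costs at most C times the measure of the symmetric difference. *)
Lemma separated_perimeter_ge (phi : 'I_N -> 'rV[R]_d -> 'rV[R]_d) (C : R) Omega :
  (forall i, C1c_field (phi i)) -> (forall i x, enorm (phi i x) <= 1) ->
  (forall i x, phi i x != 0 -> `|x| <= rho) ->
  0 <= C -> (forall i x, `|divergence (phi i) x| <= C) ->
  measurable Omega -> (mu Omega < +oo)%E -> (mu U < +oo)%E ->
  (\sum_i \int[mu]_(x in E i) (divergence (phi i) x)%:E <=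
   perimeter Omega + \sum_(i < N) C%:E * mu (symdiff Omega U))%E.
Proof.
move=> Cphi phi1 supp C0 divC mO fO fU.
pose psi i x := phi i (affine 1 (- c i) x).
have Cpsi i : C1c_field (psi i) by apply: C1c_field_affine.
have psi0 i x : psi i x != 0 -> `|x - c i| <= rho.
  by rewrite /psi /affine scale1r; exact: supp.
have Dpsi i x : divergence (psi i) x = divergence (phi i) (affine 1 (- c i) x).
  have [dphi _ _] := (C1c_fieldP (phi i)).1 (Cphi i).
  by rewrite (divergence_affine (dphi (affine 1 (- c i) x))) mul1r.
have psi1 i x : enorm (psi i x) <= 1 by exact: phi1.
have divpsiC i x : `|divergence (psi i) x| <= C by rewrite Dpsi.
have divpsi0 i x : rho < `|x - c i| -> divergence (psi i) x = 0.
  by rewrite Dpsi => h; apply: (divergence_out (supp i)); rewrite /affine scale1r.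
clearbody psi.
have [CPhi divPhi] := C1c_field_sum Cpsi.
have Phi1 x : enorm ((\sum_i psi i) x) <= 1.
  rewrite fct_sumE.
  have [/existsP[i ix]|] := boolP [exists i, psi i x != 0].
    rewrite (bigD1 i)//= big1 ?addr0// => j ji; apply/eqP; apply: contraT => jx.
    by move: ji; rewrite (separated_uniq (psi0 _ _ ix) (psi0 _ _ jx)) eqxx.
  rewrite negb_exists => /forallP h; rewrite big1 ?enorm0// => i _.
  by have := h i; rewrite negbK => /eqP.
have mU := measurable_separated.
have Ei i : (\int[mu]_(x in E i) (divergence (phi i) x)%:E =
             \int[mu]_(x in U) (divergence (psi i) x)%:E)%E.
  transitivity (\int[mu]_(x in translate (E i) (c i)) (divergence (psi i) x)%:E)%E.
    rewrite translate_affine.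
    under [RHS]eq_integral do rewrite Dpsi.
    have -> := @integral_affine R d 1 (- c i) (E i) (EFin \o divergence (phi i)) ltr01 (mE i)
      (measurable_EFin_divergence (Cphi i)).
    by rewrite expr1n invr1 mul1e.
  rewrite integral_mkcond [RHS]integral_mkcond; apply: eq_integral => x _.
  rewrite /patch; case: ifPn => [/set_mem xE|/negP xE].
    by rewrite mem_set//; exists i.
  case: ifPn => // /set_mem[j _ xj]; rewrite divpsi0// ltNge; apply/negP => xi.
  by apply: xE; rewrite (separated_uniq xi (translate_near xj)); exact: mem_set.
apply: (@le_trans _ _ (\sum_i (\int[mu]_(x in Omega) (divergence (psi i) x)%:E +
    C%:E * mu (symdiff Omega U)))%E).
  apply: lee_sum => i _; rewrite Ei.
  by apply: integral_symdiff => //; exact: measurable_divergence.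
rewrite big_split /= leeD2r//.
  apply: le_trans (divergence_le_perimeter Omega CPhi Phi1).
  under eq_integral do rewrite divPhi -sumEFin.
  rewrite integral_sum// => i.
  by apply: bounded_integrable (measurable_divergence (Cpsi i)) (divpsiC i) mO fO.
Qed.

(** Omega is cut along the pieces. The interactions between the parts are dropped,
and each part is compared with the full piece by truncation. The hypothesis on
K is the conclusion of [riesz_truncate]: K must not depend on the pieces or on
their positions. *)
Lemma separated_riesz_le s (K : R) Omega : 0 <= K ->
  (forall A B, measurable A -> measurable B -> A `<=` B ->
    (riesz s B <= riesz s A + (K%:E + mu B) * mu (B `\` A) *+ 2)%E) ->
  measurable Omega ->
  (\sum_i riesz s (E i) <= riesz s Omega + \sum_i (K%:E + mu (E i)) * mu (symdiff Omega U) *+ 2)%E.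
Proof.
move=> K0 H mO.
pose D i := Omega `&` translate (E i) (c i).
have mT i : measurable (translate (E i) (c i)) by exact: measurable_translate.
have mD i : measurable (D i) by exact: measurableI.
apply: (@le_trans _ _ (\sum_i (riesz s (D i) + (K%:E + mu (E i)) * mu (symdiff Omega U) *+ 2))%E).
  apply: lee_sum => i _; rewrite -(riesz_translate s (c i) (mE i)).
  apply: le_trans (H (D i) _ (mD i) (mT i) _) _; first exact: subIsetr.
  rewrite leeD2l// !mule2n lebesgue_translate//.
  have h : (mu (translate (E i) (c i) `\` D i) <= mu (symdiff Omega U))%E.
    apply: le_measure; rewrite ?inE.
    - exact: measurableD.
    - by apply: measurableU; apply: measurableD => //; exact: measurable_separated.
    - move=> x [Ex nD]; right; split; first by exists i.
      by move=> Ox; apply: nD; split.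
  by apply: leeD; apply: lee_wpmul2l => //; rewrite adde_ge0.
rewrite big_split /= leeD2r//; apply: riesz_bigsetU => //; last by move=> i; exact: subIsetl.
apply/trivIsetP => i j _ _ ij; rewrite -subset0 => x [[_ xi] [_ xj]].
by have /trivIsetP/(_ i j I I ij) <- := trivIset_translate.
Qed.

End separated.
End perimeter_theory.

(** * Energies of balls and of scattered balls *)

Section null_sets.
Context {R : realType} {d : nat}.
Implicit Types (A B D E : set 'rV[R]_d) (s : R).
Let mu := @lebesgue_rV R d.

Lemma symdiffC A B : symdiff A B = symdiff B A.
Proof. by rewrite /symdiff setUC. Qed.

Lemma setD_null A B : measurable A -> measurable B -> mu (symdiff A B) = 0%E ->
  mu (A `\` B) = 0%E.
Proof.
move=> mA mB AB; apply/eqP; rewrite eq_le measure_ge0 andbT -AB.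
apply: le_measure; rewrite ?inE; first exact: measurableD.
  by apply: measurableU; exact: measurableD.
by move=> x Hx; left.
Qed.

Lemma lebesgue_null A B : measurable A -> measurable B -> mu (symdiff A B) = 0%E ->
  mu A = mu B.
Proof.
wlog suff W : A B / measurable A -> measurable B -> mu (symdiff A B) = 0%E -> (mu A <= mu B)%E.
  by move=> mA mB AB; apply/eqP; rewrite eq_le !W// symdiffC.
move=> mA mB /(setD_null mA mB) AB.
rewrite -(setUIDK A B) measureU; [|exact: measurableI|exact: measurableD|].
  rewrite [X in (_ + X)%E](_ : _ = 0%E) ?adde0; last exact: AB.
  by apply: le_measure; rewrite ?inE; [exact: measurableI|exact: mB|exact: subIsetr].
by rewrite -subset0 => y [[_ ?] [_]].
Qed.

Lemma riesz_null s A B : 0 < s -> s < d%:R -> measurable A -> measurable B ->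
  mu (symdiff A B) = 0%E -> riesz s A = riesz s B.
Proof.
move=> s0 sd; have [K K0 H] := @riesz_truncate R d s s0 sd.
wlog suff W : A B / measurable A -> measurable B -> mu (symdiff A B) = 0%E -> (riesz s A <= riesz s B)%E.
  by move=> mA mB AB; apply/eqP; rewrite eq_le !W// symdiffC.
move=> mA mB /(setD_null mA mB) AB.
have mAB := measurableI _ _ mA mB.
apply: le_trans (H (A `&` B) A mAB mA (@subIsetl _ _ _)) _.
have -> : A `\` (A `&` B) = A `\` B.
  by apply/seteqP; split => x [Ax nB]; split => //; [move=> Bx; apply: nB|move=> [_ /nB]].
rewrite [mu (A `\` B)]AB mule0 mule2n !adde0 !rieszE.
by apply: le_mutual => //; exact: subIsetr.
Qed.

End null_sets.

Section balls.
Context {R : realType} {d : nat}.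
Implicit Types (A B D E : set 'rV[R]_d) (x y v c : 'rV[R]_d) (r s u : R).
Let mu := @lebesgue_rV R d.
Hypothesis d0 : (0 < d)%N.

Let B1 : set 'rV[R]_d := eball 0 1.

(** The volume u is measured in units of the volume of the unit ball. *)
Definition ball_energy s u : R :=
  fine (perimeter B1) * u `^ (1 - 1 / d%:R) + fine (riesz s B1) * u `^ (2 - s / d%:R).

Let d0' : 0 < d%:R :> R. Proof. by rewrite ltr0n. Qed.

Lemma perimeter_eball c r : 0 < r ->
  perimeter (eball c r) = (((r ^+ d) `^ (1 - 1 / d%:R))%:E * perimeter B1)%E.
Proof.
move=> r0; rewrite (eball_affine c r0) perimeter_affine ?invr_gt0//; last exact: measurable_eball.
congr (_%:E * _)%E; rewrite exprVn invrK -(powR_mulrn d (ltW r0)) -powRrM.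
rewrite mulrBr mulr1 mul1r mulfV ?gt_eqF// mulrC powRB; last by apply/implyP => _; rewrite gt_eqF.
by rewrite powRr1// ltW.
Qed.

Lemma riesz_eball s c r : 0 < r ->
  riesz s (eball c r) = (((r ^+ d) `^ (2 - s / d%:R))%:E * riesz s B1)%E.
Proof.
move=> r0; rewrite (eball_affine c r0) riesz_scale ?invr_gt0//; last exact: measurable_eball.
congr (_%:E * _)%E; rewrite !exprVn !invrK -!(powR_mulrn d (ltW r0)) -powRrM.
rewrite -powR_inv1 ?(ltW r0)// -powRrM -!powRD; try by apply/implyP => _; rewrite gt_eqF.
congr (_ `^ _); field; exact: lt0r_neq0.
Qed.

Lemma energy0_eball s c r : 0 < r -> perimeter B1 \is a fin_num -> riesz s B1 \is a fin_num ->
  energy0 s (eball c r) = (ball_energy s (r ^+ d))%:E.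
Proof.
move=> r0 fP fQ; rewrite /energy0 perimeter_eball// riesz_eball// /ball_energy EFinD !EFinM.
by rewrite !fineK// muleC [X in (_ + X)%E]muleC.
Qed.

Lemma exists_far_point (T : R) : 0 <= T -> exists c : 'rV[R]_d, `|c| = T.
Proof.
move=> T0; pose e : 'rV[R]_d := const_mx 1.
have e0 : 0 < `|e|.
  rewrite normr_gt0; apply/eqP => /rowP/(_ (Ordinal d0)) /eqP.
  by rewrite !mxE oner_eq0.
exists ((T / `|e|) *: e); rewrite normrZ ger0_norm ?divr_ge0 ?(ltW e0)//.
by rewrite divfK// gt_eqF.
Qed.

Lemma root_radius u : 0 < u -> 0 < u `^ (1 / d%:R) /\ (u `^ (1 / d%:R)) ^+ d = u.
Proof.
move=> u0; split; first exact: powR_gt0.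
by rewrite -powR_mulrn ?powR_ge0// -powRrM mul1r mulVf ?gt_eqF// powRr1// ltW.
Qed.

(** Balls are added one at a time. By subadditivity the perimeter does not exceed
the sum, and the interaction with what is already there tends to 0 as the new
ball moves away; boundedness of the union leaves room for the next ball. *)
Lemma scattered_balls s (us : seq R) (eps : R) :
  perimeter B1 \is a fin_num -> riesz s B1 \is a fin_num -> 0 < s -> s < d%:R ->
  (forall u, u \in us -> 0 < u) -> 0 < eps ->
  exists Omega : set 'rV[R]_d, [/\ measurable Omega,
    exists rho : R, forall x, Omega x -> `|x| <= rho,
    mu Omega = ((\sum_(u <- us) u)%:E * mu B1)%E &
    (energy0 s Omega <= (\sum_(u <- us) ball_energy s u + eps)%:E)%E].
Proof.
move=> fP fQ s0 sd; elim: us eps => [|u us IH] eps uspos eps0.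
  exists set0; split => //; first by exists 0.
    by rewrite measure0 big_nil mul0e.
  rewrite /energy0 big_nil add0r rieszE /mutual integral_set0 adde0.
  apply: perimeter_le => phi _ _; rewrite integral_set0 lee_fin; exact: ltW.
have eps20 : 0 < eps / 2 by rewrite divr_gt0.
have [|O [mO [rho Orho] muO EO]] := IH (eps / 2) _ eps20.
  by move=> w wus; apply: uspos; rewrite inE wus orbT.
have u0 : 0 < u by apply: uspos; rewrite mem_head.
have [r0 rd] := root_radius u0; set r := u `^ _ in r0 rd.
have mub c : mu (eball c r) = (u%:E * mu B1)%E by rewrite lebesgue_eball// rd.
pose a := fine (mu O); pose b := fine (u%:E * mu B1)%E.
have fB1 : mu B1 \is a fin_num by exact: lebesgue_unit_ball_fin.
have fO : mu O = a%:E by rewrite /a fineK// muO fin_numM.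
have fb : (u%:E * mu B1)%E = b%:E by rewrite /b fineK// fin_numM.
have a0 : 0 <= a by apply: fine_ge0.
have b0 : 0 <= b by apply: fine_ge0; rewrite -(mub 0).
(* L is the distance at which the interaction a b / L^s drops below eps / 4. *)
pose k := 4 * (a * b) / eps + 1.
have k1 : 1 <= k by rewrite lerDr divr_ge0 ?(ltW eps0)// mulr_ge0// mulr_ge0.
have k0 : 0 < k by lra.
pose L := k `^ (1 / s).
have L0 : 0 < L by exact: powR_gt0.
have Ls : L `^ s = k by rewrite /L -powRrM mul1r mulVf ?gt_eqF// powRr1// ltW.
have [c cE] := @exists_far_point (L + r + `|rho|) (addr_ge0 (addr_ge0 (ltW L0) (ltW r0)) (normr_ge0 _)).
have mB := measurable_eball c r.
have inB x : eball c r x -> `|x - c| <= r.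
  by rewrite /eball /= => /ltW; apply: le_trans; exact: norm_le_enorm.
have far x y : O x -> eball c r y -> L <= enorm (x - y).
  move=> /Orho xr /inB yr; apply: le_trans (norm_le_enorm _).
  have : `|c| <= `|x| + `|x - y| + `|y - c|.
    have Ec : c = x - (x - y) - (y - c) by apply/rowP => i; rewrite !mxE; ring.
    by rewrite {1}Ec; apply: le_trans (ler_normB _ _) _; rewrite lerD2r; exact: ler_normB.
  have := ler_norm rho; rewrite cE; lra.
have disj : [disjoint eball c r & O].
  rewrite disj_set2E; apply/eqP; rewrite -subset0 => x [xB xO].
  by have := far x x xO xB; rewrite subrr enorm0 leNgt L0.
have mBO := measurableU _ _ mB mO.
exists (eball c r `|` O); split => //.
- exists (`|c| + r + `|rho|) => x [/inB xr|/Orho xr].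
    have : `|x| <= `|x - c| + `|c| by rewrite -[X in `|X| <= _](subrK c); exact: ler_normD.
    have := normr_ge0 rho; lra.
  have := ler_norm rho; have := normr_ge0 c; lra.
- have -> : mu (eball c r `|` O) = (mu (eball c r) + mu O)%E.
    by apply: measureU => //; apply/eqP; rewrite -disj_set2E.
  by rewrite mub muO big_cons EFinD ge0_muleDl// lee_fin ?(ltW u0)// big_seq sumr_ge0// => w wus;
    by rewrite ltW// uspos// inE wus orbT.
rewrite /energy0 rieszE mutualDl// !mutualDr// -!rieszE.
have h1 := perimeter_setU mB mO disj.
have h2 := mutual_le_far L0 (ltW s0) mO mB far.
rewrite [mutual s (eball c r) O]mutualC//; set m := mutual s O _ in h2 *.
have EB := energy0_eball c r0 fP fQ; rewrite rd in EB.
have mle : (m <= (eps / 4)%:E)%E.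
  apply: le_trans h2 _; rewrite mub Ls fb fO -!EFinM lee_fin -mulrA mulrC ler_pdivrMr//.
  have -> : eps / 4 * k = a * b + eps / 4 by rewrite /k; field; rewrite gt_eqF.
  by rewrite [b * a]mulrC lerDl divr_ge0// ltW.
(* p, q are perimeters, a1, a2 Riesz energies, and z is the interaction. *)
have regroup (p q a1 a2 z : \bar R) :
    ((p + q) + ((a1 + z) + (z + a2)) = ((p + a1) + (q + a2)) + (z + z))%E.
  by rewrite (addeC z a2) (addeACA a1 z a2 z) (addeA (p + q)) (addeACA p q a1 a2).
apply: (le_trans (leeD h1 (lexx _))); rewrite regroup.
rewrite big_cons.
have -> : (ball_energy s u + \sum_(j <- us) ball_energy s j + eps)%:E =
  ((ball_energy s u)%:E + (\sum_(j <- us) ball_energy s j + eps / 2)%:E +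
   ((eps / 4)%:E + (eps / 4)%:E))%E.
  by rewrite -!EFinD; congr (_%:E); lra.
apply: leeD; last exact: leeD.
by apply: leeD; [rewrite -EB|exact: EO].
Qed.

End balls.

(** * The energy in the limit *)

Section splitting.
Context {R : realType} {d : nat}.
Let mu := @lebesgue_rV R d.

(** A quantitative lower semicontinuity: with eps fixed, almost optimal fields are
fixed first, which fixes a radius rho' for the pieces and for the supports of
the fields; then n is taken so large that the pieces are separated and the
errors are at most eps. *)
Lemma splitting_energy_le (N : nat) (E : 'I_N -> set 'rV[R]_d) (m : 'I_N -> R)
    (Om : nat -> set 'rV[R]_d) (c : nat -> 'I_N -> 'rV[R]_d) (s rho T : R) (e : nat -> R) :
  0 < s -> s < d%:R ->
  (forall i, measurable (E i)) -> (forall i x, E i x -> `|x| <= rho) ->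
  (forall i, mu (E i) = (m i)%:E) -> (forall i, perimeter (E i) \is a fin_num) ->
  (forall n, measurable (Om n)) -> (forall n, mu (Om n) < +oo)%E ->
  (forall i j, i != j -> enorm (c n i - c n j) @[n --> \oo] --> +oo) ->
  (mu (symdiff (Om n) (\bigcup_i translate (E i) (c n i))) @[n --> \oo] --> 0%E) ->
  e n @[n --> \oo] --> 0 ->
  (forall n, (energy0 s (Om n) <= (T + e n)%:E)%E) ->
  \sum_i (fine (perimeter (E i)) + fine (riesz s (E i))) <= T.
Proof.
move=> s0 sd mE Erho muE fP mO fO far sym0 e0 eO.
apply/ler_addgt0Pr => eps eps0.
have [K K0 HK] := @riesz_truncate R d s s0 sd.
pose kap := eps / (4 * N.+1%:R).
have N0 : 0 < 4 * N.+1%:R :> R by rewrite mulr_gt0.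
have kap0 : 0 < kap by rewrite divr_gt0.
have /choice[phi Hphi] : forall i, exists phi, [/\ C1c_field phi,
    forall x, enorm (phi x) <= 1 &
    ((fine (perimeter (E i)) - kap)%:E <= \int[mu]_(x in E i) (divergence phi x)%:E)%E].
  move=> i; have [_ [phi [Cphi phi1] <-] h] := ub_ereal_sup_adherent kap0 (fP i).
  exists phi; split => //; apply: le_trans (ltW h).
  by rewrite EFinB fineK// fP.
have Cphi i : C1c_field (phi i) by have [] := Hphi i.
have phi1 i x : enorm (phi i x) <= 1 by have [_ + _] := Hphi i; exact.
have /choice[Cs HCs] : forall i, exists C : R, 0 <= C /\ forall x, `|divergence (phi i) x| <= C.
  by move=> i; have [C C0 HC] := divergence_bounded (Cphi i); exists C.
have /choice[rs Hrs] : forall i, exists r : R, forall x, phi i x != 0 -> `|x| <= r.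
  by move=> i; have [_ _] := (C1c_fieldP (phi i)).1 (Cphi i).
pose C := \sum_i Cs i.
have Cs0 i : 0 <= Cs i by have [] := HCs i.
have C0 : 0 <= C by apply: sumr_ge0.
have divC i x : `|divergence (phi i) x| <= C.
  apply: le_trans ((HCs i).2 x) _; rewrite /C (bigD1 i)//= lerDl.
  by apply: sumr_ge0 => j _; exact: Cs0.
clearbody C.
pose rho' := `|rho| + \sum_i `|rs i|.
have Erho' i x : E i x -> `|x| <= rho'.
  move=> /Erho /le_trans; apply; apply: le_trans (ler_norm _) _.
  by rewrite lerDl sumr_ge0.
have supp i x : phi i x != 0 -> `|x| <= rho'.
  move=> /Hrs /le_trans; apply; apply: le_trans (ler_norm _) _.
  by rewrite /rho' (bigD1 i)//= addrCA lerDl addr_ge0// sumr_ge0.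
have m0 i : 0 <= m i by rewrite -lee_fin -muE.
pose A := \sum_(i < N) C + \sum_(i < N) (K + m i) *+ 2.
have A0 : 0 <= A.
  by rewrite addr_ge0// sumr_ge0// => i _; rewrite mulrn_wge0// addr_ge0.
(* A collects all the coefficients of the measure of the symmetric difference. *)
pose eta := eps / (4 * (A + 1)).
have A40 : 0 < 4 * (A + 1) by rewrite mulr_gt0// ltr_wpDl.
have eta0 : 0 < eta by rewrite divr_gt0.
have Aeta : A * eta <= eps / 4.
  rewrite /eta mulrA ler_pdivrMr// (_ : eps / 4 * (4 * (A + 1)) = A * eps + eps); last by field.
  by rewrite lerDl ltW.
have [n [farn symn en]] : exists n, [/\ forall i j, i != j -> rho' *+ 2 < `|c n i - c n j|,
    (mu (symdiff (Om n) (\bigcup_i translate (E i) (c n i))) <= eta%:E)%E & e n <= eps / 4].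
  have far1 : \forall n \near \oo, forall i j, i != j -> rho' *+ 2 < `|c n i - c n j|.
    have H (ij : 'I_N * 'I_N) : \forall n \near \oo, ij.1 != ij.2 -> rho' *+ 2 < `|c n ij.1 - c n ij.2|.
      have [->|ij12] := eqVneq ij.1 ij.2; first by apply: nearW => n.
      have /cvgryPgt/(_ (d%:R * (rho' *+ 2))) := far _ _ ij12.
      apply: filterS => n h _; have := lt_le_trans h (enorm_le_norm _).
      by rewrite ltr_pM2l// (lt_trans s0).
    have G : \forall n \near \oo, forall ij : 'I_N * 'I_N,
        ij.1 != ij.2 -> rho' *+ 2 < `|c n ij.1 - c n ij.2| by exact: filter_forall.
    near=> n => i j ij; have : forall ij : 'I_N * 'I_N, ij.1 != ij.2 -> rho' *+ 2 < `|c n ij.1 - c n ij.2| by near: n; exact: G.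
    by move=> /(_ (i, j)); exact.
  have sym1 : \forall n \near \oo, (mu (symdiff (Om n) (\bigcup_i translate (E i) (c n i))) <= eta%:E)%E.
    have eta0' : (0 < eta%:E)%E by rewrite lte_fin.
    by near=> n; apply: ltW; near: n; exact: (sym0 _ (open_ereal_lt' eta0')).
  have e1 : \forall n \near \oo, e n <= eps / 4.
    have eps40 : 0 < eps / 4 by rewrite divr_gt0.
    by near=> n; apply: le_trans (ler_norm _) _; near: n; exact: cvgr0_norm_le.
  have [n [[h1 h2] h3]] := filter_ex (filterI (filterI far1 sym1) e1).
  by exists n; split.
set U := \bigcup_i translate (E i) (c n i) in symn.
have mU : measurable U by exact: measurable_separated.
have fU : (mu U < +oo)%E.
  apply: (@lebesgue_bounded _ _ _ (rho' + \sum_i `|c n i|)) => // x [i _ [y Ey <-]].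
  apply: le_trans (ler_normD _ _) _; apply: lerD; first exact: Erho' Ey.
  by rewrite (bigD1 i)//= lerDl sumr_ge0.
have perl := separated_perimeter_ge mE Erho' farn Cphi phi1 supp C0 divC (mO n) (fO n) fU.
have riel := separated_riesz_le mE Erho' farn K0 HK (mO n).
rewrite -/U in perl riel.
have rfin i : riesz s (E i) \is a fin_num.
  by apply: riesz_fin => //; rewrite -/mu muE.
rewrite big_split /=.
have perl' : ((\sum_i (fine (perimeter (E i)) - kap))%:E <=
    perimeter (Om n) + (\sum_(i < N) C * eta)%:E)%E.
  rewrite -sumEFin; apply: (@le_trans _ _ (\sum_i \int[mu]_(x in E i) (divergence (phi i) x)%:E)%E).
    by apply: lee_sum => i _; have [] := Hphi i.
  apply: le_trans perl _; apply: leeD2l; rewrite -sumEFin; apply: lee_sum => i _.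
  by rewrite EFinM; apply: lee_wpmul2l.
have riel' : ((\sum_i fine (riesz s (E i)))%:E <=
    riesz s (Om n) + (\sum_(i < N) (K + m i) * eta *+ 2)%:E)%E.
  rewrite -sumEFin; under eq_bigr do rewrite fineK//.
  apply: le_trans riel _; apply: leeD2l; rewrite -sumEFin; apply: lee_sum => i _.
  have h : ((K%:E + mu (E i)) * mu (symdiff (Om n) U) <= ((K + m i) * eta)%:E)%E.
    by rewrite muE -EFinD EFinM; apply: lee_wpmul2l => //; rewrite lee_fin addr_ge0.
  by rewrite mule2n [X in (_ <= X%:E)%E]mulr2n EFinD; exact: leeD.
have := leeD perl' riel'; rewrite addeACA => h.
have {h} := le_trans h (leeD (eO n) (lexx _)).
rewrite -!EFinD lee_fin.
have -> : \sum_(i < N) C * eta + \sum_(i < N) (K + m i) * eta *+ 2 = A * eta.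
  by rewrite /A mulrDl !mulr_suml; congr (_ + _); apply: eq_bigr => i _; rewrite mulrnAl.
rewrite sumrB sumr_const card_ord.
have kapN : kap *+ N <= eps / 4.
  rewrite -mulr_natr /kap mulrAC ler_pdivrMr// (_ : eps / 4 * _ = eps * N.+1%:R); last by field.
  by rewrite ler_pM2l// ler_nat.
lra.
Unshelve. all: by end_near.
Qed.

End splitting.

(** * Comparison of masses *)

Section conclusion.
Context {R : realType} {d : nat}.
Let mu := @lebesgue_rV R d.

(** Dropping the attraction of the competitor only raises its energy; that of Om is
at most C + M. *)
Lemma competitor_bound p s Z M (Om Om' : set 'rV[R]_d) (C T : R) :
  0 <= Z -> 0 <= C ->
  (forall E : set 'rV[R]_d, measurable E -> (attraction p E <= C%:E + mu E)%E) ->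
  minimizer (energy p s Z) M Om -> measurable Om' -> mu Om' = M%:E ->
  (energy0 s Om' <= T%:E)%E -> (energy0 s Om <= (T + Z * (C + M))%:E)%E.
Proof.
move=> Z0 C0 HC [mO muO minO] mO' muO' EO'.
have attr0 (E : set 'rV[R]_d) : (0 <= attraction p E)%E.
  by apply: integral_ge0 => x _; rewrite lee_fin invr_ge0 powR_ge0.
have le1 : (energy p s Z Om <= energy p s Z Om')%E.
  by rewrite minO; apply: ereal_inf_lbound; exists Om'.
have le2 : (energy p s Z Om' <= T%:E)%E.
  apply: le_trans EO'; rewrite /energy -[leRHS]sube0 leeB// mule_ge0//.
have := le_trans le1 le2; have := HC Om mO; rewrite muO -EFinD /energy => hC.
have fa : (Z%:E * attraction p Om)%E \is a fin_num.
  by rewrite fin_numM// ge0_fin_numE//; apply: le_lt_trans hC _; rewrite ltry.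
rewrite leeBlDr// => /le_trans; apply; rewrite EFinD leeD2l//.
by rewrite EFinM; apply: lee_wpmul2l.
Qed.

(** The other masses are kept, so their contributions cancel. *)
Lemma equal_of_pairwise_minimal (N : nat) (f : R -> R) (u : 'I_N -> R) (i j : 'I_N) (t : R) :
  i != j -> (forall k, 0 < u k) -> 0 < t -> t < u i + u j ->
  (forall w : 'I_N -> R, (forall k, 0 < w k) -> \sum_k w k = \sum_k u k ->
     \sum_k f (u k) <= \sum_k f (w k)) ->
  f (u i) + f (u j) <= f t + f (u i + u j - t).
Proof.
move=> ij u0 t0 tlt H.
pose w k := if k == i then t else if k == j then u i + u j - t else u k.
have ji : j != i by rewrite eq_sym.
have wi : w i = t by rewrite /w eqxx.
have wj : w j = u i + u j - t by rewrite /w (negbTE ji) eqxx.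
have wk k : k != i -> k != j -> w k = u k by rewrite /w => /negbTE -> /negbTE ->.
have split2 (g : 'I_N -> R) : \sum_k g k = g i + (g j + \sum_(k | (k != i) && (k != j)) g k).
  by rewrite (bigD1 i)//= (bigD1 j).
have w0 k : 0 < w k.
  by rewrite /w; case: ifP => // _; case: ifP => // _; rewrite subr_gt0.
have := H w w0; rewrite !split2 wi wj.
rewrite (eq_bigr u); last by move=> k /andP[? ?]; exact: wk.
rewrite [X in _ -> _ <= _ + (_ + X)](eq_bigr (f \o u)); last first.
  by move=> k /andP[? ?] /=; rewrite wk.
by move=> /(_ _); rewrite addrA [t + _]addrC subrK addrA => /(_ erefl); rewrite !addrA lerD2r.
Qed.

Lemma translate0 (A : set 'rV[R]_d) : translate A 0 = A.
Proof.
by apply/seteqP; split => x; [move=> [y Ay <-]|move=> Ax; exists x]; rewrite ?addr0.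
Qed.

End conclusion.

Theorem theorem5 (R : realType) (d : nat) (p s sbar M : R)
    (Omega : R -> set 'rV[R]_d) (Zs : nat -> R)
    (N : nat) (m : 'I_N.+1 -> R) (E : 'I_N.+1 -> set 'rV[R]_d)
    (hd : (2 <= d)%N) (hp : 0 < p) (hps : p < s) (hsd : s < d%:R)
    (hsbar : critical_exponent d sbar) (hs : s < sbar) (hM : 0 < M)
    (hOmega : forall Z : R, 0 < Z -> minimizer (energy p s Z) M (Omega Z))
    (hZs : forall n, 0 < Zs n) (hZs0 : Zs n @[n --> \oo] --> 0)
    (hAB : compact_alternative s M (fun n => Omega (Zs n)) m E \/
           splitting_alternative p s M Zs (fun n => Omega (Zs n)) m E) :
  forall i : 'I_N.+1,
    [/\ ae_ball (E i), lebesgue_rV d (E i) = (m i)%:E & m i = M / N.+1%:R].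
Proof.
have s0 : 0 < s by exact: lt_trans hps.
have d0 : (0 < d)%N by exact: ltnW.
have [_ ball_of_minimizer] := hsbar.
case: hAB => [[N0 m0 min0 _] i|[_ m_gt0 sum_m HE [x [[x0 _ x_far] _ sym0 minE _]]] i].
  move: m E i m0 min0; rewrite N0 => m E i m0 min0; rewrite (ord1 i).
  have [mE muE _] := min0; split; [exact: ball_of_minimizer min0|by rewrite m0|by rewrite m0 divr1].
have mE k : measurable (E k) by apply: compact_measurable_rV; have [] := HE k.
have muE k : lebesgue_rV d (E k) = (m k)%:E by have [] := HE k.
have perE k : (perimeter (E k) < +oo)%E by have [] := HE k.
have ballE k : ae_ball (E k).
  by apply: (ball_of_minimizer s s0 hs hsd (m k)) => //; split.
split=> //.
have /choice[c Hc] : forall k, exists cr : 'rV[R]_d * R, 0 < cr.2 /\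
    lebesgue_rV d (symdiff (E k) (eball cr.1 cr.2)) = 0%E.
  by move=> k; have [c [r r0 H]] := ballE k; exists (c, r).
have r0 k : 0 < (c k).2 by have [] := Hc k.
have nullE k := (Hc k).2.
have mB k := measurable_eball (c k).1 (c k).2.
pose u k := (c k).2 ^+ d.
have u0 k : 0 < u k by exact: exprn_gt0.
pose V := fine (lebesgue_rV d (eball 0 1 : set 'rV[R]_d)).
have VE := @lebesgue_unit_ballE R d; rewrite -/V in VE.
have mV k : m k = u k * V.
  have := lebesgue_null (mE k) (mB k) (nullE k).
  by rewrite muE lebesgue_eball// VE -EFinM => -[].
have V0 : 0 < V by have := m_gt0 ord0; rewrite mV pmulr_rgt0.
have fE k : perimeter (E k) \is a fin_num by rewrite ge0_fin_numE// perimeter_ge0.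
have ltyE k : (lebesgue_rV d (E k) < +oo)%E by rewrite muE ltry.
have ltyB k : (lebesgue_rV d (eball (c k).1 (c k).2) < +oo)%E.
  by rewrite -(lebesgue_null (mE k) (mB k) (nullE k)).
have perEB k : perimeter (E k) = perimeter (eball (c k).1 (c k).2).
  exact: perimeter_null.
(* Up to scaling the unit ball is E ord0, whose perimeter is finite. *)
have fP : perimeter (eball 0 1 : set 'rV[R]_d) \is a fin_num.
  have hk : 0 < u ord0 `^ (1 - 1 / d%:R) by apply: powR_gt0; exact: u0.
  have := fE ord0; rewrite perEB perimeter_eball//.
  case: (perimeter (eball 0 1)) (perimeter_ge0 (eball 0 1 : set 'rV[R]_d)) => // _.
  by rewrite gt0_muley ?lte_fin.
have fQ : riesz s (eball 0 1 : set 'rV[R]_d) \is a fin_num.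
  by apply: riesz_fin => //; [exact: measurable_eball|rewrite VE].
have energyE k : fine (perimeter (E k)) + fine (riesz s (E k)) = ball_energy (d := d) s (u k).
  rewrite perEB (riesz_null s0 hsd (mE k) (mB k) (nullE k)) perimeter_eball// riesz_eball//.
  by rewrite /ball_energy !fineM//= mulrC [X in _ + X]mulrC.
have u_minimal : forall w : 'I_N.+1 -> R, (forall k, 0 < w k) -> \sum_k w k = \sum_k u k ->
    \sum_k ball_energy (d := d) s (u k) <= \sum_k ball_energy (d := d) s (w k).
  move=> w w0 wu; apply/ler_addgt0Pr => eps eps0.
  have [|O [mO _ muO EO]] := @scattered_balls R d d0 s [seq w k | k <- index_enum 'I_N.+1] eps fP fQ s0 hsd _ eps0.
    by move=> z /mapP[k _ ->].
  rewrite !big_map in muO EO.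
  have {}muO : lebesgue_rV d O = M%:E.
    rewrite muO VE -EFinM wu -sum_m mulr_suml; congr (_%:E).
    by apply: eq_bigr => k _; rewrite mV.
  have [C C0 HC] := @attraction_bound R d p hp (lt_trans hps hsd).
  under eq_bigr do rewrite -energyE.
  have [rho Erho] : exists rho, forall k y, E k y -> `|y| <= rho.
    have /choice[rs Hrs] : forall k, exists r : R, forall y, E k y -> `|y| <= r.
      move=> k; have [/compact_bounded[r [_ H]] _ _] := HE k.
      by exists (r + 1) => y Ey; apply: H => //; rewrite ltrDl.
    exists (\sum_k `|rs k|) => k y /Hrs /le_trans; apply; apply: le_trans (ler_norm _) _.
    by rewrite (bigD1 k)//= lerDl sumr_ge0.
  apply: (@splitting_energy_le R d N.+1 E m (fun n => Omega (Zs n)) x s rho _ (fun n => Zs n * (C + M))) => //.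
  - by move=> n; have [] := hOmega _ (hZs n).
  - by move=> n; have [_ -> _] := hOmega _ (hZs n); rewrite ltry.
  - have EU n : \bigcup_k translate (E k) (x n k) =
        E ord0 `|` \bigcup_(k in [set~ ord0]) translate (E k) (x n k).
      apply/seteqP; split => z.
        move=> [k _ Hz]; have [k0|k0] := eqVneq k ord0; last by right; exists k => //; exact/eqP.
        by left; move: Hz; rewrite k0 x0 translate0.
      by move=> [Ez|[k _ Hz]]; [exists ord0 => //; rewrite x0 translate0|exists k].
    by under eq_fun do rewrite EU.
  - rewrite -(mul0r (C + M)); apply: cvgM => //; exact: cvg_cst.
  - move=> n; apply: competitor_bound (ltW (hZs n)) C0 HC (hOmega _ (hZs n)) mO muO EO.
have all_equal k : u k = u i.
  have [->//|ki] := eqVneq k i.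
  have d2 : 2 <= d%:R :> R by rewrite ler_nat.
  have dp : 0 < d%:R :> R by rewrite ltr0n.
  apply: (@minimizing_pair_equal R (fine (perimeter (eball 0 1 : set 'rV[R]_d)))
     (fine (riesz s (eball 0 1 : set 'rV[R]_d))) (1 - 1 / d%:R) (2 - s / d%:R)) => //.
  - exact: fine_ge0 (perimeter_ge0 _).
  - rewrite fine_gt0// riesz_unit_ball_gt0 ?VE ?lte_fin//= -ge0_fin_numE//; exact: mutual_ge0.
  - by rewrite subr_gt0 ltr_pdivrMr// mul1r; lra.
  - by rewrite ltrBlDr ltrDl divr_gt0.
  - by rewrite ltrBrDr -ltrBrDl (_ : 2 - 1 = 1) ?ltr_pdivrMr ?mul1r//; lra.
  - by rewrite ltrBlDr ltrDl divr_gt0.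
  - move=> t t0 tlt; exact: (@equal_of_pairwise_minimal R N.+1 (ball_energy (d := d) s) u k i t).
rewrite -sum_m (eq_bigr (fun=> m i)); last by move=> k _; rewrite !mV all_equal.
by rewrite sumr_const card_ord -[X in X / _]mulr_natr mulfK// pnatr_eq0.
Qed.
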